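(* Let $n,r\ge1$ and let $\mathbb F$ be a field which is a $\mathbb Z[v,v^{-1}]$-algebra in which the image $z$ of $v$ is not a root of unity. Then every simple $\mathcal S_\vartriangle(n,r)_{\mathbb F}$-module is finite dimensional.
   Context: The extended affine Hecke algebra $\mathcal H_\vartriangle(r)$ over $\mathbb Z[v,v^{-1}]$ is generated by $T_{s_i}$ ($1\le i\le r$) and $T_\rho^{\pm1}$ with relations $T_{s_i}^2=(v^2-1)T_{s_i}+v^2$; $T_{s_i}T_{s_j}=T_{s_j}T_{s_i}$ if $i-j\not\equiv\pm1\pmod r$; $T_{s_i}T_{s_j}T_{s_i}=T_{s_j}T_{s_i}T_{s_j}$ if $i-j\equiv\pm1\pmod r$ and $r\ge3$; $T_\rho T_\rho^{-1}=T_\rho^{-1}T_\rho=1$; $T_\rho T_{s_i}=T_{s_{i+1}}T_\rho$ (with $T_{s_{r+1}}=T_{s_1}$). For $w\in\mathfrak S_r$ let $T_w=T_{s_{i_1}}\cdots T_{s_{i_m}}$ for a reduced expression $w=s_{i_1}\cdots s_{i_m}$. $\Lambda_\vartriangle(n,r)$ is the set of compositions $\lambda=(\lambda_1,\dots,\lambda_n)\in\mathbb N^n$ of $r$; $\mathfrak S_\lambda$ the Young subgroup of $\mathfrak S_r$ and $x_\lambda=\sum_{w\in\mathfrak S_\lambda}T_w$. $\mathcal H_\vartriangle(r)_{\mathbb F}=\mathcal H_\vartriangle(r)\otimes\mathbb F$ and the affine $q$-Schur algebra is $\mathcal S_\vartriangle(n,r)_{\mathbb F}=\mathrm{End}_{\mathcal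 H_\vartriangle(r)_{\mathbb F}}\big(\bigoplus_{\lambda\in\Lambda_\vartriangle(n,r)}x_\lambda\mathcal H_\vartriangle(r)_{\mathbb F}\big)$. The field $\mathbb F$ is assumed large enough. *)

(* Defs.v *)
(* Extended affine Hecke algebra (given by its universal
   property w.r.t. the presentation), the affine q-Schur algebra as
   End_H(+_lambda x_lambda H), its modules, simplicity, finite dimension. *)
From HB Require Import structures.
From mathcomp Require Import all_boot all_order all_algebra all_fingroup.
Set Implicit Arguments. Unset Strict Implicit. Unset Printing Implicit Defensive.
Import GRing.Theory.
Local Open Scope ring_scope.

(* generators s_1..s_r are indexed by 'I_r (0-based): index k stands for s_{k+1} *)
Definition adjmod (r : nat) (i j : 'I_r) : bool :=
  (i == ordS j :> nat) || (j == ordS i :> nat).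

Definition hecke_rels (F : fieldType) (z : F) (r : nat) (A : algType F)
    (T : 'I_r -> A) (R Ri : A) : Prop :=
  [/\ forall i, T i * T i = (z ^+ 2 - 1) *: T i + (z ^+ 2)%:A,
      forall i j, ~~ adjmod i j -> T i * T j = T j * T i,
      (2 < r)%N -> forall i j, adjmod i j -> T i * T j * T i = T j * T i * T j,
      R * Ri = 1 /\ Ri * R = 1 &
      forall i, R * T i = T (ordS i) * R ].

Definition is_alg_hom (F : fieldType) (A B : algType F) (f : A -> B) : Prop :=
  [/\ forall x y, f (x + y) = f x + f y,
      forall x y, f (x * y) = f x * f y,
      f 1 = 1 &
      forall (c : F) x, f (c *: x) = c *: f x].

(* (H, T, R, Ri) is the F-algebra presented by the generators T_{s_i}, T_rho,
   T_rho^{-1} and the relations above (universal / initial property) *)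
Definition is_ext_aff_hecke (F : fieldType) (z : F) (r : nat) (H : algType F)
    (T : 'I_r -> H) (R Ri : H) : Prop :=
  hecke_rels z T R Ri /\
  forall (A : algType F) (TA : 'I_r -> A) (RA RAi : A), hecke_rels z TA RA RAi ->
    exists f : H -> A,
      [/\ is_alg_hom f, (forall i, f (T i) = TA i), f R = RA, f Ri = RAi &
          forall g : H -> A, is_alg_hom g -> (forall i, g (T i) = TA i) ->
            g R = RA -> g Ri = RAi -> forall h, g h = f h].

Definition sref (r : nat) (k : 'I_r) : 'S_r := tperm k (ordS k).

Definition perm_len (r : nat) (w : 'S_r) : nat :=
  #|[set p : 'I_r * 'I_r | (p.1 < p.2)%N && (w p.2 < w p.1)%N]|.

Definition redword (r : nat) (w : 'S_r) (t : seq 'I_r) : bool :=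
  all (fun k : 'I_r => (k.+1 < r)%N) t && ((\prod_(k <- t) sref k)%g == w).

Definition Tw (F : fieldType) (r : nat) (H : algType F) (T : 'I_r -> H)
    (w : 'S_r) : H :=
  if [pick t : (perm_len w).-tuple 'I_r | redword w t] is Some t
  then \prod_(k <- t) T k else 0.

Definition comp_of (n r : nat) :=
  {l : {ffun 'I_n -> 'I_r.+1} | (\sum_(i < n) (l i : nat))%N == r}.

(* 0-based index of the block of lambda containing position p *)
Definition blk (n r : nat) (l : {ffun 'I_n -> 'I_r.+1}) (p : 'I_r) : nat :=
  #|[set k : 'I_n | (\sum_(j < n | (j <= k)%N) (l j : nat) <= p)%N]|.

Definition young (n r : nat) (l : comp_of n r) : {set 'S_r} :=
  [set w : 'S_r | [forall p : 'I_r, blk (val l) (w p) == blk (val l) p]].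

Section Schur.
Variables (F : fieldType) (H : algType F) (n r : nat) (T : 'I_r -> H).

Definition xl (l : comp_of n r) : H := \sum_(w in young l) Tw T w.

(* the right H-module  P = (+)_lambda x_lambda H  *)
Definition Pt : Type :=
  {v : comp_of n r -> H | forall l, exists h, v l = xl l * h}.

Lemma Padd_proof (u w : Pt) :
  forall l, exists h, (fun l => sval u l + sval w l) l = xl l * h.
Proof.
move=> l; case: (svalP u l) => a Ha; case: (svalP w l) => b Hb.
by exists (a + b); rewrite /= Ha Hb mulrDr.
Qed.
Definition Padd (u w : Pt) : Pt := exist _ _ (Padd_proof u w).

Lemma Pmulr_proof (u : Pt) (h : H) :
  forall l, exists h', (fun l => sval u l * h) l = xl l * h'.
Proof.
move=> l; case: (svalP u l) => a Ha.
by exists (a * h); rewrite /= Ha mulrA.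
Qed.
Definition Pmulr (u : Pt) (h : H) : Pt := exist _ _ (Pmulr_proof u h).

Definition isEnd (phi : Pt -> Pt) : Prop :=
  (forall u w, phi (Padd u w) = Padd (phi u) (phi w)) /\
  (forall u h, phi (Pmulr u h) = Pmulr (phi u) h).

Definition is_Smod (M : lmodType F) (act : (Pt -> Pt) -> M -> M) : Prop :=
  [/\ forall phi, isEnd phi -> forall (a : F) (m m' : M),
         act phi (a *: m + m') = a *: act phi m + act phi m',
      forall m, act id m = m,
      forall phi psi, isEnd phi -> isEnd psi -> forall m,
         act (fun u => phi (psi u)) m = act phi (act psi m),
      forall phi psi, isEnd phi -> isEnd psi -> forall m,
         act (fun u => Padd (phi u) (psi u)) m = act phi m + act psi m &
      forall phi (c : F), isEnd phi -> forall m,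
         act (fun u => Pmulr (phi u) c%:A) m = c *: act phi m].

Definition is_Ssubmod (M : lmodType F) (act : (Pt -> Pt) -> M -> M)
    (N : M -> Prop) : Prop :=
  [/\ N 0, forall m m', N m -> N m' -> N (m + m') &
      forall phi m, isEnd phi -> N m -> N (act phi m)].

Definition is_Ssimple (M : lmodType F) (act : (Pt -> Pt) -> M -> M) : Prop :=
  (exists m : M, m != 0) /\
  forall N : M -> Prop, is_Ssubmod act N -> (forall m, N m -> m = 0) \/ (forall m, N m).

End Schur.

Definition findim (F : fieldType) (M : lmodType F) : Prop :=
  exists (d : nat) (b : 'I_d -> M),
    forall m : M, exists c : 'I_d -> F, m = \sum_(i < d) c i *: b i.

(* Main.v *)
(* Write [q = z^2] and let [H] be the Hecke algebra.  Since [q] is not a root of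
   unity, every [x_lambda] is a multiple of an idempotent.  Hence a simple
   module [M] over [End_H(+_lambda x_lambda H)] is spanned by finitely many images
   of [H/K], where [K] is a maximal left ideal of [H].  By the Bernstein
   presentation [H] is a finitely generated left module over a finitely generated
   commutative subalgebra [A], so that [H/K] has a nonzero [A]-quotient that is
   finite dimensional by the Nullstellensatz; maximality of [K] embeds [H/K] into
   a finite power of that quotient. *)
Require Import Defs.
From HB Require Import structures.
From mathcomp Require Import all_boot all_order all_algebra all_fingroup.
From mathcomp Require Import zify ring_quotient boolp classical_sets.
Set Implicit Arguments. Unset Strict Implicit. Unset Printing Implicit Defensive.
Import GRing.Theory.
Local Open Scope ring_scope.

(** * Zariski's lemma *)

(** When [n < r] the composition with [r] parts equal to 1 is absent, so [H] is not a corner of the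
    Schur algebra and [M] has no component on which [H] acts. What replaces it is an element [y]
    with [x y x = x] for each [x = x_lambda]: then [x H] is a direct summand of [H], every component
    of an endomorphism is left multiplication by some [x_mu * g], and the [h] for which all maps
    built from the multiples [g * h] kill a fixed vector of [M] form the maximal left ideal [K]. [H]
    is known only by its universal property, so no basis is at hand: the [T_w] serve as a spanning
    family over [A], and [x_lambda] is compared with a separately built symmetrizer instead of being
    expanded. As [F] is an arbitrary field, residue fields of [A] may be proper extensions of [F];
    Zariski's lemma takes the place of characters. *)

Inductive generated (R : pzRingType) (G : R -> Prop) : R -> Prop :=
| gen_in x : G x -> generated G x
| gen_add x y : generated G x -> generated G y -> generated G (x + y)
| gen_mul x y : generated G x -> generated G y -> generated G (x * y).

Lemma generated_sub (R : pzRingType) (G G' : R -> Prop) :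
  (forall x, G x -> generated G' x) ->
  forall x, generated G x -> generated G' x.
Proof.
move=> sG x; elim=> [y /sG //|y t _ Hy _ Ht|y t _ Hy _ Ht].
  exact: gen_add.
exact: gen_mul.
Qed.

Section Fractions.
Variables (R : comNzRingType) (L : fieldType) (ev : {rmorphism R -> L}).

(** The subfield of [L] generated by the image of [ev]. Staying inside [L] gives a field even when
    [ev] is not injective, as for [K[X]] evaluated at an algebraic element. *)
Definition fractions : {pred L} :=
  fun y => `[< exists p q, ev q != 0 /\ y = ev p / ev q >].

Lemma fractions_image p : ev p \in fractions.
Proof.
by apply/asboolP; exists p, 1; rewrite rmorph1 oner_neq0 divr1.
Qed.

Lemma fractions_divring : divring_closed fractions.
Proof.
split.
- by rewrite -(rmorph1 ev) fractions_image.
- move=> u v /asboolP[p [q [q0 ->]]] /asboolP[p' [q' [q'0 ->]]].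
  apply/asboolP; exists (p * q' - p' * q), (q * q').
  rewrite rmorphB !rmorphM mulf_neq0 //; split=> //.
  by rewrite -[- (ev p' / _)]mulNr addf_div // mulNr.
move=> u v /asboolP[p [q [q0 ->]]] /asboolP[p' [q' [q'0 ->]]].
apply/asboolP; have [p'0|p'0] := eqVneq (ev p') 0.
  by exists 0, 1; rewrite p'0 mul0r invr0 mulr0 rmorph0 mul0r rmorph1 oner_neq0.
exists (p * q'), (q * p'); rewrite !rmorphM mulf_neq0 //; split=> //.
by rewrite invf_div mulf_div.
Qed.

HB.instance Definition _ := GRing.isDivringClosed.Build L fractions
  fractions_divring.

Inductive fracField := FracField x & x \in fractions.
Definition frac_val u := let: FracField x _ := u in x.
HB.instance Definition _ := [isSub for frac_val].
HB.instance Definition _ := [Choice of fracField by <:].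
HB.instance Definition _ := [SubChoice_isSubUnitRing of fracField by <:].
HB.instance Definition _ := [SubNzRing_isSubComNzRing of fracField by <:].
HB.instance Definition _ := [SubComUnitRing_isSubIntegralDomain of fracField by <:].
HB.instance Definition _ := [SubIntegralDomain_isSubField of fracField by <:].

Lemma common_denominator (s : seq fracField) :
  exists2 D, ev D != 0 & forall u, u \in s -> exists a, val u * ev D = ev a.
Proof.
elim: s => [|u s [D D0 HD]]; first by exists 1 => //; rewrite rmorph1 oner_neq0.
have /asboolP[p [q [q0 Eu]]] := valP u.
exists (q * D) => [|v]; first by rewrite rmorphM mulf_neq0.
rewrite inE => /predU1P[->|/HD[a Ea]].
  by exists (p * D); rewrite Eu !rmorphM mulrA divfK.
by exists (a * q); rewrite rmorphM (mulrC (ev q)) mulrA Ea rmorphM.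
Qed.

(** Scaling a root by [D] multiplies the coefficient of degree [i] by [D ^ (d - i)]. Below degree
    [d] this contains a factor [D], which clears the denominator; the leading coefficient stays
    1. *)
Lemma integral_clear_denominator (y : L) :
  integralOver (val : fracField -> L) y ->
  exists2 D, ev D != 0 & integralOver ev (ev D * y).
Proof.
case=> p mon_p /rootP py0.
have [D D0 HD] := common_denominator p; exists D => //.
have sp : (0 < size p)%N by rewrite size_poly_gt0 monic_neq0.
pose d := (size p).-1.
have def_d : size p = d.+1 by rewrite /d prednK.
pose q := \poly_(i < d.+1) (val p`_i * ev D ^+ (d - i)).
have qd : q`_d = 1.
  rewrite coef_poly ltnSn subnn mulr1.
  by have /monicP := mon_p; rewrite lead_coefE -/d => ->; rewrite rmorph1.
have mon_q : q \is monic.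
  apply/monicP; rewrite lead_coefE.
  suff -> : size q = d.+1 by [].
  apply/eqP; rewrite eqn_leq size_poly /= ltnNge; apply: contraTN isT => ltq.
  by have /eqP := qd; rewrite nth_default // eq_sym oner_eq0.
apply: (integral_root_monic mon_q).
  apply/rootP; rewrite horner_poly.
  rewrite -[RHS](mulr0 (ev D ^+ d)) -[in RHS]py0 horner_coef size_map_poly def_d.
  rewrite mulr_sumr; apply: eq_bigr => i _; rewrite coef_map /=.
  rewrite exprMn mulrA -(mulrA (val _)) -exprD subnK; last by rewrite -ltnS.
  by rewrite -mulrA mulrCA.
apply/integral_poly => i; rewrite coef_poly; case: ifP => lei; last exact: integral0.
have [->|nei] := eqVneq i d.
  have := qd; rewrite coef_poly ltnSn => ->; exact: integral1.
have lti : (i < d)%N by rewrite ltn_neqAle nei -ltnS.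
have /HD[a Ea] : p`_i \in (p : seq _) by rewrite mem_nth // def_d.
rewrite -(subnSK lti) exprS mulrA.
by rewrite Ea -rmorphXn -rmorphM; apply: integral_id.
Qed.

End Fractions.

(** The rational root argument: after multiplying the monic equation of [a / b] by [b ^ d], every
    term except the leading one is divisible by [b]. *)
Lemma integral_fraction (R : comNzRingType) (L : fieldType)
    (ev : {rmorphism R -> L}) (a b : R) :
  injective ev -> b != 0 -> integralOver ev (ev a / ev b) ->
  exists d c, a ^+ d = b * c.
Proof.
move=> injev b0 [g mon_g /rootP gu0].
have eb0 : ev b != 0 by rewrite -(rmorph0 ev) (inj_eq injev).
pose d := (size g).-1.
have def_d : size g = d.+1.
  by rewrite /d prednK // size_poly_gt0 monic_neq0.
exists d, (- \sum_(i < d) g`_i * a ^+ i * b ^+ (d - i.+1)).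
apply: injev; apply/eqP; rewrite rmorphM rmorphN mulrN -addr_eq0.
rewrite -[X in _ == X](mulr0 (ev b ^+ d)) -[in X in _ == X]gu0.
rewrite horner_coef size_map_poly_id0; last first.
  by rewrite (monicP mon_g) rmorph1 oner_neq0.
rewrite def_d big_ord_recr /= mulrDr addrC rmorph_sum !mulr_sumr; apply/eqP.
congr (_ + _).
  apply: eq_bigr => i _; rewrite coef_map /= !rmorphM !rmorphXn expr_div_n.
  have -> : ev b ^+ d = ev b * ev b ^+ (d - i.+1) * ev b ^+ i.
    by rewrite -exprS -exprD subnSK // subnK // ltnW.
  rewrite (mulrA (ev g`_i)) [RHS]mulrACA divff ?expf_neq0 // mulr1 -[RHS]mulrA.
  by congr (_ * _); rewrite mulrC.
rewrite coef_map /=; have /monicP := mon_g; rewrite lead_coefE -/d => ->.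
by rewrite rmorph1 mul1r expr_div_n mulrC divfK ?expf_neq0 // rmorphXn.
Qed.

(** The base field varies in the induction: it grows to the field generated by the first generator
    [x], over which [L] is then algebraic. What remains is the integrality of [x] over [K].
    Otherwise [K[X]] embeds in [L], and a single [f] has the property that some [ev f ^+ N * y] is
    integral over [K[X]] for each [y] of [L]; the inverse of a suitable polynomial contradicts
    this. *)
Lemma zariski n (K L : fieldType) (iota : {rmorphism K -> L}) (xs : seq L) :
  size xs = n ->
  (forall y, generated (fun y => (exists c, y = iota c) \/ y \in xs) y) ->
  forall y, integralOver iota y.
Proof.
elim: n K iota xs => [|n IHn] K iota xs.
  move/size0nil=> -> Hgen y; elim: (Hgen y) => [t [[c ->]|//]|t u _ Ht _ Hu|t u _ Ht _ Hu].
  - exact: integral_id.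
  - exact: integral_add.
  - exact: integral_mul.
case: xs => // x xs [sz_xs] Hgen.
have cx : commr_rmorph iota x by move=> c; apply: mulrC.
pose ev : {rmorphism {poly K} -> L} := horner_morph cx.
have evC c : ev c%:P = iota c by rewrite /= horner_morphC.
have evX : ev 'X = x by rewrite /= horner_morphX.
have int1 y : integralOver (val : fracField ev -> L) y.
  apply: (IHn _ _ xs sz_xs) => {}y; apply: generated_sub (Hgen y) => {}y [[c ->]|].
    by apply: gen_in; left; exists (FracField (fractions_image ev c%:P)); rewrite -evC.
  rewrite inE => /predU1P[->|yxs]; last by apply: gen_in; right.
  apply: gen_in; left; exists (FracField (fractions_image ev 'X)); by rewrite -{1}evX.
have [intx|nintx] := pselect (integralOver iota x).
  move=> y; have [p mon_p py0] := int1 y.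
  apply: (integral_root_monic _ py0); first exact: monic_map.
  apply/integral_poly => i; rewrite coef_map /=.
  have /asboolP[a [b [_ ->]]] := valP p`_i.
  apply: integral_div; rewrite /= /horner_morph; apply: integral_horner => //;
    apply/integral_poly => j; rewrite coef_map; exact: integral_id.
have inj_ev : injective ev.
  apply: raddf_inj => p p0; apply: contra_not_eq nintx => p_neq0.
  by apply/integral_algebraic; exists p => //; apply/rootP.
have [f f0 intf] : exists2 f, ev f != 0 &
    forall y, y \in xs -> integralOver ev (ev f * y).
  elim: xs {sz_xs Hgen IHn} => [|y xs [f f0 intf]].
    by exists 1 => //; rewrite rmorph1 oner_neq0.
  have [D D0 intD] := integral_clear_denominator (int1 y).
  exists (f * D) => [|u]; first by rewrite rmorphM mulf_neq0.
  rewrite inE rmorphM => /predU1P[->|/intf intu].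
    by rewrite -mulrA; apply: integral_mul => //; apply: integral_id.
  by rewrite mulrAC; apply: integral_mul => //; apply: integral_id.
have fX_int N : integralOver ev (ev f ^+ N) by rewrite -rmorphXn; apply: integral_id.
have intfN y : exists N, integralOver ev (ev f ^+ N * y).
  elim: (Hgen y) => [t [[c ->]|]|t u _ [N Nt] _ [M Mu]|t u _ [N Nt] _ [M Mu]].
  - by exists 0%N; rewrite mul1r -evC; apply: integral_id.
  - rewrite inE => /predU1P[->|/intf]; last by exists 1%N.
    by exists 0%N; rewrite mul1r -evX; apply: integral_id.
  - exists (N + M)%N; rewrite mulrDr; apply: integral_add.
      by rewrite addnC exprD -mulrA; apply: integral_mul.
    by rewrite exprD -mulrA; apply: integral_mul.
  by exists (N + M)%N; rewrite exprD mulrACA; apply: integral_mul.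
have f_neq0 : f != 0 by apply: contraNneq f0 => ->; rewrite rmorph0.
(* [P] is coprime to [f], and the factor ['X] keeps it nonconstant even when [f] is constant. Yet
   integrality of [f ^+ N / P] makes [P] divide a power of [f]. *)
pose P : {poly K} := 'X * f + 1.
have szP : size P = (size f).+1.
  rewrite /P size_polyDl; first by rewrite mulrC size_mulX.
  by rewrite mulrC size_mulX // size_poly1 ltnS size_poly_gt0.
have P0 : P != 0 by rewrite -size_poly_gt0 szP.
have [N intN] := intfN (ev P)^-1.
have [d [c /eqP E]] : exists d c, (f ^+ N) ^+ d = P * c.
  by apply: (@integral_fraction _ _ ev) => //; rewrite rmorphXn.
have copPf : coprimep P (f ^+ N ^+ d).
  do 2!apply: coprimep_expr.
  apply/Bezout_coprimepP; exists (1, - 'X).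
  by rewrite /= mul1r mulNr /P addrAC subrr add0r eqpxx.
move: copPf; rewrite (eqP E) coprimepMr coprimepp szP => /andP[/eqP[sf0] _].
by rewrite -size_poly_eq0 sf0 in f_neq0.
Qed.

(** * Spans modulo a subspace and generated subalgebras *)

Section ModSpan.
Variable F : fieldType.

Definition subspace (V : lmodType F) (N : V -> Prop) :=
  N 0 /\ forall (a : F) u v, N u -> N v -> N (a *: u + v).

Lemma subspaceD (V : lmodType F) (N : V -> Prop) u v :
  subspace N -> N u -> N v -> N (u + v).
Proof. by case=> _ hN Nu Nv; rewrite -[u]scale1r; apply: hN. Qed.

Lemma subspaceZ (V : lmodType F) (N : V -> Prop) a u :
  subspace N -> N u -> N (a *: u).
Proof. by case=> N0 hN Nu; rewrite -[_ *: _]addr0; apply: hN. Qed.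

Lemma subspaceB (V : lmodType F) (N : V -> Prop) u v :
  subspace N -> N u -> N v -> N (u - v).
Proof. by case=> _ hN Nu Nv; rewrite addrC -scaleN1r; apply: hN. Qed.

Lemma subspace_sum (V : lmodType F) (N : V -> Prop) (I : Type) (s : seq I)
    (P : pred I) (f : I -> V) :
  subspace N -> (forall i, P i -> N (f i)) -> N (\sum_(i <- s | P i) f i).
Proof.
move=> sN Nf; elim/big_ind: _ => //; first by case: sN.
by move=> *; apply: subspaceD.
Qed.

(** This expresses finite codimension of [N] without forming a quotient space, so [N] can be any
    predicate. *)
Fixpoint modspan (V : lmodType F) (N : V -> Prop) (B : seq V) (v : V) : Prop :=
  if B is b :: B' then exists c : F, modspan N B' (v - c *: b) else N v.

Lemma modspan_subspace (V : lmodType F) (N : V -> Prop) B :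
  subspace N -> subspace (modspan N B).
Proof.
move=> sN; elim: B => //= b B [IH0 IH]; split.
  by exists 0; rewrite scale0r subr0.
move=> a u v [c uc] [d vd]; exists (a * c + d).
by rewrite scalerDl opprD addrACA -scalerA -scalerBr; apply: IH.
Qed.

Lemma modspan_base (V : lmodType F) (N : V -> Prop) B v : N v -> modspan N B v.
Proof.
by move=> Nv; elim: B => //= b B IH; exists 0; rewrite scale0r subr0.
Qed.

Lemma modspan_mem (V : lmodType F) (N : V -> Prop) B v :
  N 0 -> v \in B -> modspan N B v.
Proof.
move=> N0; elim: B => //= b B IH; rewrite inE => /predU1P[->|/IH vB].
  by exists 1; rewrite scale1r subrr; apply: modspan_base.
by exists 0; rewrite scale0r subr0.
Qed.

Lemma modspan_elim (V : lmodType F) (N P : V -> Prop) B v :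
    subspace P -> (forall u, N u -> P u) -> (forall u, u \in B -> P u) ->
  modspan N B v -> P v.
Proof.
move=> sP sNP; elim: B v => [|b B IH] v sB /=; first exact: sNP.
case=> c /IH Pv; rewrite -[v](subrK (c *: b)); apply: subspaceD => //.
  by apply: Pv => u uB; apply: sB; rewrite inE uB orbT.
by apply: subspaceZ => //; apply: sB; rewrite mem_head.
Qed.

Lemma modspan_sub (V : lmodType F) (N N' : V -> Prop) B v :
  (forall u, N u -> N' u) -> modspan N B v -> modspan N' B v.
Proof.
move=> sN; elim: B v => [|b B IH] v /=; first exact: sN.
by case=> c /IH; exists c.
Qed.

Lemma modspan_cat (V : lmodType F) (N : V -> Prop) B B' u v :
  subspace N -> modspan N B u -> modspan N B' v -> modspan N (B ++ B') (u + v).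
Proof.
move=> sN; elim: B u => [|b B IH] u /=.
  by move=> Nu Nv; apply: subspaceD; [apply: modspan_subspace|apply: modspan_base|].
by case=> c /IH hu /hu; exists c; rewrite addrAC.
Qed.

Lemma modspan_linear (V W : lmodType F) (N : V -> Prop) (N' : W -> Prop)
    (f : V -> W) B v :
    (forall a u u', f (a *: u + u') = a *: f u + f u') ->
    (forall u, N u -> N' (f u)) ->
  modspan N B v -> modspan N' (map f B) (f v).
Proof.
move=> lf sN; elim: B v => [|b B IH] v /=; first exact: sN.
by case=> c /IH; exists c; rewrite addrC -scaleNr -lf scaleNr addrC.
Qed.

(* A subspace of a finite dimensional space is finite dimensional, phrased for
   the preimage of [N] under [f] inside [U]. *)
Lemma modspan_preimage (V W : lmodType F) (f : V -> W) (B : seq W)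
    (N : W -> Prop) (U : V -> Prop) :
    (forall a u u', f (a *: u + u') = a *: f u + f u') ->
    subspace N -> subspace U -> (forall u, U u -> modspan N B (f u)) ->
  exists B', forall u, U u -> modspan (fun w => U w /\ N (f w)) B' u.
Proof.
move=> lf sN; elim: B U => [|b B IH] U sU hU.
  by exists [::] => u Uu; split=> //; apply: hU.
pose U0 u := U u /\ modspan N B (f u).
have f0 : f 0 = 0.
  by rewrite -[0 in LHS](subrr 0) addrC -scaleN1r lf scaleN1r addNr.
have sU0 : subspace U0.
  split; first by split; [case: sU | rewrite f0; case: (modspan_subspace B sN)].
  move=> a u v [Uu Nu] [Uv Nv]; split; first by case: sU => _; apply.
  by rewrite lf; case: (modspan_subspace B sN) => _; apply.
have [B' hB'] := IH U0 sU0 (fun u => @proj2 _ _).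
have sub w : U0 w /\ N (f w) -> U w /\ N (f w) by case=> [[]].
have [hall|] := pselect (forall u, U u -> U0 u).
  by exists B' => u /hall/hB'; apply: modspan_sub.
move=> /existsNP[u0 /not_implyP[Uu0 nU0]].
have [c0 hc0] := hU _ Uu0.
have c0_neq0 : c0 != 0.
  by apply: contra_notN nU0 => /eqP c00; split=> //; rewrite c00 scale0r subr0 in hc0.
(* [U0] has codimension one in [U]: subtracting [c / c0] times [u0] cancels the coefficient on
   [b]. *)
exists (u0 :: B') => u Uu; have [c hc] := hU _ Uu; exists (c / c0).
apply: (modspan_sub sub); apply: hB'; split.
  by rewrite addrC -scaleNr; case: sU => _; apply.
rewrite addrC -scaleNr lf.
have -> : - (c / c0) *: f u0 + f u = - (c / c0) *: (f u0 - c0 *: b) + (f u - c *: b).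
  rewrite scalerBr scalerA mulNr divfK // !scaleNr opprK.
  by rewrite -addrA [c *: b + _]addrC addrNK.
by case: (modspan_subspace B sN) => _; apply.
Qed.

End ModSpan.

Section GeneratedAlgebra.
Variables (F : fieldType) (H : algType F) (G : H -> Prop).

Definition alg_gens (x : H) : Prop := (exists c : F, x = c%:A) \/ G x.

Definition genalg_pred : {pred H} := fun h => `[< generated alg_gens h >].

Lemma genalg_pred_closed : subalg_closed genalg_pred.
Proof.
have scal (c : F) : generated alg_gens c%:A by apply: gen_in; left; exists c.
split.
- by apply/asboolP; rewrite -[1]scale1r.
- move=> a u v /asboolP gu /asboolP gv; apply/asboolP.
  by apply: gen_add => //; rewrite -mulr_algl; apply: gen_mul.
- by move=> u v /asboolP gu /asboolP gv; apply/asboolP; apply: gen_mul.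
Qed.

HB.instance Definition _ := GRing.isSubalgClosed.Build F H genalg_pred
  genalg_pred_closed.

Inductive genAlg := GenAlg x & x \in genalg_pred.
Definition genalg_val u := let: GenAlg x _ := u in x.
HB.instance Definition _ := [isSub for genalg_val].
HB.instance Definition _ := [Choice of genAlg by <:].
HB.instance Definition _ := [SubChoice_isSubAlgebra of genAlg by <:].

End GeneratedAlgebra.

(** * The Nullstellensatz *)

Definition ideal_prop (A : pzRingType) (I : A -> Prop) :=
  I 0 /\ forall a u v, I u -> I v -> I (a * u + v).

(** In a noncommutative ring these are left ideals; the same predicate serves [H] and its
    commutative subalgebra. The last clause states maximality as left invertibility modulo [I]. *)
Definition maximal_ideal (A : pzRingType) (I : A -> Prop) :=
  [/\ ideal_prop I, ~ I 1 & forall a, ~ I a -> exists b, I (1 - b * a)].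

Lemma exists_maximal_ideal (A : pzRingType) (I : A -> Prop) :
  ideal_prop I -> ~ I 1 ->
  exists m, maximal_ideal m /\ forall a, I a -> m a.
Proof.
move=> idI I1.
(* Zorn's lemma for unions also asks about the empty chain, whose union is empty and hence no ideal.
   Adding [I] to every set turns that union into [I]. *)
pose ext (X : set A) a := X a \/ I a.
pose P (X : set A) := ideal_prop (ext X) /\ ~ ext X 1.
have [Fm FP totF|X [[idX X1] maxX]] := @Zorn_bigcup A P.
  split; last first.
    by case=> // -[X FX X1]; case: (FP _ FX) => _; apply; left.
  split=> [|a u v]; first by right; case: idI.
  case=> [[X FX Xu]|Iu] [[Y FY Yv]|Iv].
  - have [sub|sub] := totF _ _ FX FY.
      have [[_ hY] _] := FP _ FY.
      by have [] := hY a u v (or_introl (sub _ Xu)) (or_introl Yv); [left; exists Y|right].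
    have [[_ hX] _] := FP _ FX.
    by have [] := hX a u v (or_introl Xu) (or_introl (sub _ Yv)); [left; exists X|right].
  - have [[_ hX] _] := FP _ FX.
    by have [] := hX a u v (or_introl Xu) (or_intror Iv); [left; exists X|right].
  - have [[_ hY] _] := FP _ FY.
    by have [] := hY a u v (or_intror Iu) (or_introl Yv); [left; exists Y|right].
  - by right; case: idI => _; apply.
exists (ext X); split; last by right.
split=> // a na; apply: contrapT => hb.
(* The left ideal generated by [a] and [ext X]. By [hb] it is proper, which contradicts the
   maximality of [X]. *)
pose J : set A := fun x => exists b u, ext X u /\ x = b * a + u.
have extX0 : ext X 0 by case: idX.
have XJ u : ext X u -> J u by move=> hu; exists 0, u; rewrite mul0r add0r.
have extJ x : ext J x -> J x by case=> // Ix; apply: XJ; right.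
suff [h1 h2] : (X `<` J)%classic /\ P J by apply: (maxX J h1 h2).
split.
  split=> [u Xu|JX]; first by apply: XJ; left.
  by apply: na; left; apply: JX; exists 1, 0; rewrite mul1r addr0.
split; last first.
  move/extJ => [b [u [Xu E]]]; apply: hb; exists b.
  by rewrite E addrAC subrr add0r.
split; first by left; apply: XJ.
move=> c u v /extJ[b [s [Xs ->]]] /extJ[b' [s' [Xs' ->]]]; left.
exists (c * b + b'), (c * s + s'); split; first by case: idX => _; apply.
by rewrite mulrDr mulrDl addrACA !mulrA.
Qed.

Section ResidueField.
Variables (A : comNzRingType) (m : A -> Prop) (hm : maximal_ideal m).

(** The proof of maximality is an argument so that the ideal and field instances can recover it from
    the type. *)
Definition residue_pred of maximal_ideal m : {pred A} := fun a => `[< m a >].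
Local Notation mP := (residue_pred hm).

Lemma residue_pred_closed : idealr_closed mP.
Proof.
have [[m0 mD] m1 _] := hm; split; first exact/asboolP.
  exact/asboolPn.
by move=> a u v /asboolP mu /asboolP mv; apply/asboolP; apply: mD.
Qed.

HB.instance Definition _ := isIdealr.Build A mP residue_pred_closed.

Definition residue := {ideal_quot mP}.
HB.instance Definition _ := GRing.ComNzRing.on residue.

Definition residue_map (a : A) : residue := (\pi_residue a)%qT.

Lemma residue_mapB : zmod_morphism residue_map.
Proof. by move=> a b; rewrite /residue_map !piE. Qed.
Lemma residue_mapM : monoid_morphism residue_map.
Proof. by split=> [|a b]; rewrite /residue_map !piE. Qed.
HB.instance Definition _ := GRing.isZmodMorphism.Build A residue residue_map
  residue_mapB.
HB.instance Definition _ := GRing.isMonoidMorphism.Build A residue residue_map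
  residue_mapM.

Lemma residue_surj (x : residue) : exists a, x = residue_map a.
Proof. by elim/quotW: x => a; exists a. Qed.

Lemma residue_map_eq0 a : (residue_map a == 0) = (a \in mP).
Proof. by rewrite /residue_map -(rmorph0 residue_map) -Quotient.idealrBE subr0. Qed.

Definition residue_inv (x : residue) : residue :=
  if pselect (exists y, y * x = 1) is left h then sval (cid h) else 0.

Lemma residue_mulVf x : x != 0 -> residue_inv x * x = 1.
Proof.
rewrite /residue_inv => x0; case: pselect => [h|]; first by case: cid.
case; have [a Ea] := residue_surj x; rewrite {x}Ea residue_map_eq0 in x0 *.
have [_ _ /(_ a)[|b mb]] := hm; first by move/asboolPn: x0.
exists (residue_map b); rewrite -rmorphM; apply/esym/eqP; rewrite -subr_eq0.
by rewrite -(rmorph1 residue_map) -rmorphB residue_map_eq0; apply/asboolP.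
Qed.

Lemma residue_inv0 : residue_inv 0 = 0.
Proof.
rewrite /residue_inv; case: pselect => // h; case: cid => y /= /eqP.
by rewrite mulr0 eq_sym oner_eq0.
Qed.

HB.instance Definition _ := GRing.ComNzRing_isField.Build residue
  residue_mulVf residue_inv0.

End ResidueField.

Section Nullstellensatz.
Variables (F : fieldType) (A : comAlgType F).

Lemma ideal_subspace (I : A -> Prop) : ideal_prop I -> subspace I.
Proof.
by case=> I0 hI; split=> // a u v Iu Iv; rewrite -mulr_algl; apply: hI.
Qed.

(** Adjoining an element [x] with a monic relation of degree [d] modulo [m] multiplies the spanning
    family by the powers of [x] below [d]. *)
Lemma modspan_adjoin (m : A -> Prop) (xs : seq A) :
    ideal_prop m ->
    (forall x, x \in xs -> exists2 p : {poly F}, p \is monic &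
       m (horner_alg x p)) ->
  exists B, modspan m B 1 /\
    forall x v, x \in xs -> modspan m B v -> modspan m B (x * v).
Proof.
move=> idm; have sm := ideal_subspace idm.
elim: xs => [|x xs IH] int_xs.
  by exists [:: 1]; split=> //; apply: modspan_mem; [case: idm|rewrite mem_head].
have [y yxs|B [B1 HB]] := IH.
  by apply: int_xs; rewrite inE yxs orbT.
have [p mon_p px] := int_xs x (mem_head _ _).
have mM a u : m u -> m (a * u).
  by case: idm => m0 hm mu; rewrite -[_ * _]addr0; apply: hm.
pose d := (size p).-1.
have def_d : size p = d.+1 by rewrite /d prednK // size_poly_gt0 monic_neq0.
pose B' := [seq b * x ^+ i | b <- B, i <- iota 0 d].
have sB' := modspan_subspace B' sm.
have hX i v : modspan m B v -> modspan m B' (v * x ^+ i).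
  elim/ltn_ind: i v => i IHi v hv.
  pose Q u := modspan m B' (u * x ^+ i).
  have [lti|lei] := ltnP i d.
    apply: (@modspan_elim _ _ m Q B) hv.
    - split; first by rewrite /Q mul0r; case: sB'.
      by move=> a u w Qu Qw; rewrite /Q mulrDl -scalerAl; case: sB' => _; apply.
    - by move=> u mu; rewrite /Q mulrC; apply/modspan_base/mM.
    - move=> u uB; apply: modspan_mem; first by case: idm.
      by apply: allpairs_f => //; rewrite mem_iota.
  (* As [p] is monic, [v * x ^+ i] is the top term of the product, which lies in [m]. The other
     terms carry smaller powers of [x]. *)
  have -> : v * x ^+ i = v * x ^+ (i - d) * horner_alg x p
      - \sum_(j < d) p`_j *: (v * x ^+ (i - d + j)).
    rewrite /horner_alg /horner_morph horner_coef size_map_poly_id0; last first.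
      by rewrite (monicP mon_p) rmorph1 oner_neq0.
    rewrite def_d big_ord_recr /= mulrDr mulr_sumr coef_map /=.
    have /monicP := mon_p; rewrite lead_coefE -/d => ->.
    rewrite scale1r mul1r -mulrA -exprD subnK //.
    rewrite addrAC -[LHS]add0r; congr (_ + _); apply/esym/eqP; rewrite subr_eq0.
    apply/eqP/eq_bigr => j _; rewrite coef_map /= mulr_algl exprD.
    by rewrite -scalerAr mulrA.
  apply: subspaceB => //; first exact/modspan_base/mM.
  apply: subspace_sum => // j _; apply: subspaceZ => //; apply: IHi => //.
  by rewrite -[X in (_ < X)%N](subnK lei) ltn_add2l.
exists B'; split; first by rewrite -[1]mulr1 -(expr0 x); apply: hX.
move=> y v; rewrite inE => yx.
apply: (@modspan_elim _ _ m (fun v => modspan m B' (y * v)) B').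
- split; first by rewrite mulr0; case: sB'.
  by move=> a u w hu hw; rewrite mulrDr -scalerAr; case: sB' => _; apply.
- by move=> u mu; apply/modspan_base/mM.
move=> u /allpairsP[[b i] /= [bB _ ->]]; case/predU1P: yx => [->|yxs].
  rewrite mulrCA -exprS; apply: hX; apply: modspan_mem => //; by case: idm.
rewrite mulrA; apply/hX/HB => //; apply: modspan_mem => //; by case: idm.
Qed.

(** The residue field at a maximal ideal above [I] is a finitely generated algebra over [F], hence
    algebraic by Zariski's lemma. The monic equations of the generators lift to relations modulo
    [m], so finitely many monomials span. *)
Lemma nullstellensatz (xs : seq A) (I : A -> Prop) :
    (forall a, generated (alg_gens (fun x => x \in xs)) a) ->
    ideal_prop I -> ~ I 1 ->
  exists m B, [/\ ideal_prop m, ~ m 1, forall a, I a -> m a &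
    forall a, modspan m B a].
Proof.
move=> genA idI I1; have [m [hm Im]] := exists_maximal_ideal idI I1.
have [idm m1 _] := hm.
pose iota : {rmorphism F -> residue hm} := residue_map hm \o in_alg A.
have int_A y : integralOver iota y.
  apply: (@zariski _ _ _ iota (map (residue_map hm) xs)) => // {}y.
  have [a ->] := residue_surj y; 
  elim: (genA a) => [x [[c ->]|xxs]|x t _ Hx _ Ht|x t _ Hx _ Ht].
  - by apply: gen_in; left; exists c.
  - by apply: gen_in; right; apply: map_f.
  - by rewrite rmorphD; apply: gen_add.
  - by rewrite rmorphM; apply: gen_mul.
have [x xxs|B [B1 HB]] := @modspan_adjoin m xs idm.
  have [p mon_p px] := int_A (residue_map hm x); exists p => //.
  apply/asboolP; rewrite -[X in is_true X](residue_map_eq0 hm).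
  rewrite /horner_alg /horner_morph.
  by rewrite -horner_map -map_poly_comp.
exists m, B; split=> // a; rewrite -[a]mulr1.
have sB := modspan_subspace B (ideal_subspace idm).
elim: (genA a) (1) B1 => [x [[c ->]|xxs]|x y _ Hx _ Hy|x y _ Hx _ Hy] v hv.
- by rewrite mulr_algl; apply: subspaceZ.
- exact: HB.
- by rewrite mulrDl; apply: subspaceD; [|exact: Hx|exact: Hy].
- by rewrite -mulrA; apply/Hx/Hy.
Qed.

End Nullstellensatz.

(** * Maximal left ideals of algebras finite over a commutative subalgebra *)

Section MaximalLeftIdeals.
Variables (F : fieldType) (H : algType F) (X : seq H).
Hypothesis commX : {in X &, forall x y, x * y = y * x}.

Local Notation inA := (generated (alg_gens (fun x => x \in X))).

Lemma genalg_comm a b : inA a -> inA b -> a * b = b * a.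
Proof.
move=> ha; elim: ha b => [x Hx|x y _ IHx _ IHy|x y _ IHx _ IHy] b hb.
- elim: hb => [y Hy|y t _ IHy _ IHt|y t _ IHy _ IHt].
  + case: Hx Hy => [[c ->]|xX] [[d ->]|yX].
    * by rewrite !mulr_algl !scalerA mulrC.
    * by rewrite mulr_algl mulr_algr.
    * by rewrite mulr_algl mulr_algr.
    * exact: commX.
  + by rewrite mulrDl mulrDr IHy IHt.
  + by rewrite mulrA IHy -mulrA IHt mulrA.
- by rewrite mulrDl mulrDr IHx ?IHy.
- by rewrite -mulrA IHy // mulrA IHx // mulrA.
Qed.

Definition comGenAlg of {in X &, forall x y, x * y = y * x} :=
  genAlg (fun x => x \in X).
Local Notation A := (comGenAlg commX).
HB.instance Definition _ := GRing.Algebra.on A.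

Definition coval (a : A) : H := val (a : genAlg (fun x => x \in X)).
Lemma covalD a b : coval (a + b) = coval a + coval b.
Proof. exact: (rmorphD (val : genAlg (fun x => x \in X) -> H)). Qed.
Lemma covalM a b : coval (a * b) = coval a * coval b.
Proof. exact: (rmorphM (val : genAlg (fun x => x \in X) -> H)). Qed.
Lemma coval1 : coval 1 = 1.
Proof. exact: (rmorph1 (val : genAlg (fun x => x \in X) -> H)). Qed.
Lemma coval0 : coval 0 = 0.
Proof. exact: (rmorph0 (val : genAlg (fun x => x \in X) -> H)). Qed.
Lemma covalZ c a : coval (c *: a) = c *: coval a.
Proof. exact: (linearZZ (val : genAlg (fun x => x \in X) -> H)). Qed.
Lemma coval_inA a : inA (coval a).
Proof. by rewrite /coval; case: a => x /= /asboolP. Qed.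
Lemma coval_inj : injective coval.
Proof. exact: val_inj. Qed.
Lemma coval_surj h : inA h -> exists a, coval a = h.
Proof. by move/asboolP=> hh; exists (GenAlg (hh : h \in genalg_pred _)). Qed.

Lemma comGenAlg_mulC : commutative (@GRing.mul A).
Proof.
by move=> a b; apply: coval_inj; rewrite !covalM; apply: genalg_comm; apply: coval_inA.
Qed.
HB.instance Definition _ := GRing.PzSemiRing_hasCommutativeMul.Build A comGenAlg_mulC.

Lemma comGenAlg_gen : exists xs : seq A, forall a : A,
  generated (alg_gens (fun x => x \in xs)) a.
Proof.
have [xs Exs] : exists xs : seq A, map coval xs = X.
  have : {subset X <= X} by [].
  elim: {1 3}X => [|x Y IH] sY; first by exists [::].
  have [|xs <-] := IH; first by move=> y yY; apply: sY; rewrite inE yY orbT.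
  have [|a <-] := @coval_surj x; last by exists (a :: xs).
  by apply: gen_in; right; apply: sY; rewrite mem_head.
exists xs => a; have := coval_inA a; move: {2 3}(coval a) (erefl (coval a)) => h Eh hh.
elim: hh a Eh => [x [[c ->]|xX]|x y hx IHx hy IHy|x y hx IHx hy IHy] a Eh.
- apply: gen_in; left; exists c; apply: coval_inj.
  by rewrite Eh covalZ coval1.
- by apply: gen_in; right; move: xX; rewrite -Exs -Eh mem_map //; apply: coval_inj.
- have [b Eb] := coval_surj hx; have [c Ec] := coval_surj hy.
  have -> : a = b + c by apply: coval_inj; rewrite covalD Eb Ec.
  by apply: gen_add; [apply: IHx | apply: IHy].
- have [b Eb] := coval_surj hx; have [c Ec] := coval_surj hy.
  have -> : a = b * c by apply: coval_inj; rewrite covalM Eb Ec.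
  by apply: gen_mul; [apply: IHx | apply: IHy].
Qed.

Definition A_submodule (L : H -> Prop) :=
  [/\ L 0, forall u v, L u -> L v -> L (u + v) &
      forall a u, inA a -> L u -> L (a * u)].

Lemma A_submodule_subspace L : A_submodule L -> subspace L.
Proof.
case=> L0 LD LM; split=> // a u v Lu Lv; apply: LD => //.
by rewrite -mulr_algl; apply: LM => //; apply: gen_in; left; exists a.
Qed.

Lemma inA1 : inA 1.
Proof. by rewrite -[1]scale1r; apply: gen_in; left; exists 1. Qed.

Lemma inAN a : inA a -> inA (- a).
Proof.
rewrite -mulN1r => ha; apply: gen_mul => //; apply: gen_in; left; exists (-1).
by rewrite scaleN1r.
Qed.

(** Induction on the number of generators of [H] modulo [L]. If [L1 = L + A g] is proper, it
    replaces [L] and [g] is dropped. Otherwise [H] modulo [L] is cyclic, a copy of [A] modulo the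
    annihilator [I] of [g]; the Nullstellensatz puts [I] inside an ideal [m] of finite codimension,
    and [L + m g] is the answer. *)
Lemma finite_codim_submodule (G : seq H) (L : H -> Prop) :
    A_submodule L -> (exists h, ~ L h) ->
    (forall h, exists f : H -> H, (forall g, inA (f g)) /\ L (h - \sum_(g <- G) f g * g)) ->
  exists L' B, [/\ A_submodule L', exists h, ~ L' h,
    forall h, L h -> L' h & forall h, modspan L' B h].
Proof.
elim: G L => [|g G IH] L sL [h0 Lh0] spanL.
  by have [f [_]] := spanL h0; rewrite big_nil subr0.
have [L0 LD LM] := sL.
pose L1 h := exists a, inA a /\ L (h - a * g).
have sL1 : A_submodule L1.
  split.
  - by exists (1 - 1); split; [apply: gen_add (inAN _); apply: inA1 |
      rewrite subrr mul0r subr0].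
  - move=> u v [a [ha La]] [b [hb Lb]]; exists (a + b); split; first exact: gen_add.
    by rewrite mulrDl opprD addrACA; apply: LD.
  - move=> c u hc [a [ha La]]; exists (c * a); split; first exact: gen_mul.
    by rewrite -mulrA -mulrBr; apply: LM.
have LL1 h : L h -> L1 h.
  move=> Lh; exists (1 - 1); split; first by apply: gen_add (inAN _); apply: inA1.
  by rewrite subrr mul0r subr0.
have [L1all|/existsNP L1p] := pselect (forall h, L1 h); last first.
  have [h|L' [B [sL' pL' L1L' BL']]] := IH L1 sL1 L1p.
    have [f [hf Lf]] := spanL h; exists f; split=> //; exists (f g); split=> //.
    by rewrite big_cons opprD addrA in Lf; rewrite addrAC.
  by exists L', B; split=> // h /LL1/L1L'.
pose I (a : A) := L (coval a * g).
have idI : ideal_prop I.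
  split; first by rewrite /I coval0 mul0r.
  move=> a u v Iu Iv; rewrite /I covalD covalM mulrDl -mulrA.
  by apply: LD => //; apply: LM => //; apply: coval_inA.
have I1 : ~ I 1.
  rewrite /I coval1 mul1r => Lg; apply: Lh0.
  have [a [ha La]] := L1all h0; rewrite -(subrK (a * g) h0); apply: LD => //.
  exact: LM.
have [xs genA] := comGenAlg_gen.
have [m [B [idm m1 Im BA]]] := nullstellensatz genA idI I1.
have [m0 mD] := idm.
pose L' h := exists l (a : A), [/\ L l, m a & h = l + coval a * g].
have LL' h : L h -> L' h.
  by move=> Lh; exists h, 0; split=> //; rewrite coval0 mul0r addr0.
have sL' : A_submodule L'.
  split.
  - exact: LL'.
  - move=> u v [l [a [Ll ma ->]]] [l' [a' [Ll' ma' ->]]].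
    exists (l + l'), (a + a'); split; first exact: LD.
      by rewrite -[a]mul1r; apply: mD.
    by rewrite covalD mulrDl addrACA.
  - move=> c u /coval_surj[b <-] [l [a [Ll ma ->]]].
    exists (coval b * l), (b * a); split.
    + by apply: LM => //; apply: coval_inA.
    + by rewrite -[_ * _]addr0; apply: mD.
    + by rewrite mulrDr mulrA -covalM.
exists L', [seq coval b * g | b <- B]; split=> //.
  (* If [g = l + a g] with [a] in [m], then [1 - a] annihilates [g] modulo [L], so it lies in [m] as
     well. *)
  exists g => -[l [a [Ll ma Eg]]]; apply: m1.
  have : I (1 - a).
    rewrite /I covalD coval1 -scaleN1r covalZ scaleN1r mulrBl mul1r.
    by rewrite {1}Eg addrK.
  by move/Im => ma1; have := mD 1 _ _ ma1 ma; rewrite mul1r subrK.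
move=> h; have [a [/coval_surj[b <-] La]] := L1all h.
rewrite -(subrK (coval b * g) h); apply: subspaceD.
- exact/modspan_subspace/A_submodule_subspace.
- exact/modspan_base/LL'.
apply: (@modspan_linear _ _ _ m L' (fun b : A => coval b * g)) (BA b).
  by move=> c u v; rewrite covalD covalZ mulrDl scalerAl.
by move=> u mu; exists 0, u; split=> //; rewrite add0r.
Qed.

(* Coinduction from the commutative subalgebra: [K] is recovered from [L'] as the
   set of [h] with [H h] inside [L']. *)
Lemma maximal_left_ideal_finite_codim (G : seq H) (K : H -> Prop) :
    (forall h, exists f : H -> H, (forall g, inA (f g)) /\ h = \sum_(g <- G) f g * g) ->
    maximal_ideal K -> exists B, forall h, modspan K B h.
Proof.
move=> spanG [[K0 KD] K1 maxK].
have KM a u : K u -> K (a * u) by move=> Ku; rewrite -[_ * _]addr0; apply: KD.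
have sK : A_submodule K.
  split=> // [u v Ku Kv|a u _]; last exact: KM.
  by rewrite -[u]mul1r; apply: KD.
have [||L [B [sL [h0 Lh0] KL BL]]] := @finite_codim_submodule G K sK.
- by exists 1.
- move=> h; have [f [hf Eh]] := spanG h; exists f; split=> //.
  by rewrite -Eh subrr.
have [L0 LD LM] := sL.
(* As [L] is stable under [A], the assumption puts all of [H h] in [L]. For [h] outside [K], the sum
   [K + H h] is [H], which would then lie in [L]. *)
have inK h : (forall g, g \in G -> L (g * h)) -> K h.
  move=> hG; apply: contrapT => /maxK[b Kb]; apply: Lh0.
  have -> : h0 = h0 * (1 - b * h) + h0 * b * h.
    by rewrite mulrBr mulr1 mulrA subrK.
  apply: (LD); first exact/KL/KM.
  have [f [hf ->]] := spanG (h0 * b); rewrite mulr_suml.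
  rewrite big_seq; apply: (big_ind L) => // g gG.
  by rewrite -mulrA; apply: LM => //; apply: hG.
have ssL := A_submodule_subspace sL.
(* [U G] is the kernel of the map from [H] to copies of [H] modulo [L], one for each [g] in [G],
   given by [h] going to [g * h]. Its codimension is bounded one copy at a time. *)
pose U (s : seq H) h := forall g, g \in s -> L (g * h).
have sU s : subspace (U s).
  split=> [g _|a u v Uu Uv g gs]; first by rewrite mulr0.
  by rewrite mulrDr -scalerAr; case: ssL => _; apply; [apply: Uu | apply: Uv].
suff [B' HB'] : exists B', forall h, modspan (U G) B' h.
  by exists B' => h; apply: modspan_sub (HB' h); apply: inK.
elim: (G) => [|g s [B1 HB1]]; first by exists [::] => h.
have [||B2 HB2] := @modspan_preimage _ _ _ (fun h => g * h) B L (U s) _ ssL (sU s).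
- by move=> a u v; rewrite mulrDr scalerAr.
- by move=> u _; apply: BL.
exists (B1 ++ B2) => h.
have : forall u, U s u -> modspan (U (g :: s)) B2 u.
  move=> u /HB2; apply: modspan_sub => w [Uw Lw] x.
  by rewrite inE => /predU1P[->|/Uw].
elim: B1 {HB1} h (HB1 h) => [|b B1 IHB] h /=; first by move=> Uh; apply.
by case=> c /IHB hc /hc; exists c.
Qed.

End MaximalLeftIdeals.

(** * Reduction from the Schur algebra to the Hecke algebra *)

Lemma modspan_findim (F : fieldType) (M : lmodType F) (B : seq M) :
  (forall m, modspan (fun v => v = 0) B m) -> findim M.
Proof.
move=> hB; exists (size B), (fun i => B`_i) => m.
elim: B m {hB}(hB m) => [|b B IH] m /=.
  by move=> ->; exists (fun _ => 0); rewrite big_ord0.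
case=> c /IH[d Ed].
exists (fun i => if unlift ord0 i is Some j then d j else c).
rewrite big_ord_recl unlift_none /= -[LHS](subrK (c *: b)) Ed addrC; congr (_ + _).
by apply: eq_bigr => i _; rewrite liftK.
Qed.

Section SchurReduction.
Variables (F : fieldType) (H : algType F) (n r : nat) (T : 'I_r -> H).
Local Notation P := (Pt n T).
Local Notation comp := (comp_of n r).
Local Notation x := (xl T : comp -> H).

Lemma Pt_eq (u w : P) : (forall l, sval u l = sval w l) -> u = w.
Proof.
by case: u w => u hu [w hw] /= E; apply: eq_exist; apply: funext.
Qed.

Lemma Eend_proof (mu lam : comp) (g : H) (u : P) : forall l, exists h,
  (fun nu : comp => if nu == mu then x mu * (g * sval u lam) else 0) l = x l * h.
Proof.
move=> l /=; case: eqP => [->|_]; first by exists (g * sval u lam).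
by exists 0; rewrite mulr0.
Qed.

(** The factor [x mu] puts the value in the right summand for every [g], so the parameter ranges
    over all of [H]. *)
Definition Eend (mu lam : comp) (g : H) (u : P) : P :=
  exist _ _ (Eend_proof mu lam g u).

Lemma Eend_isEnd mu lam g : isEnd (Eend mu lam g).
Proof.
split=> [u w|u h]; apply: Pt_eq => l /=; case: eqP => _.
- by rewrite !mulrDr.
- by rewrite addr0.
- by rewrite !mulrA.
- by rewrite mul0r.
Qed.

Lemma trunc_proof (s : seq comp) (u : P) : forall l, exists h,
  (fun nu : comp => if nu \in s then sval u nu else 0) l = x l * h.
Proof.
move=> l /=; case: ifP => _; first exact: (svalP u l).
by exists 0; rewrite mulr0.
Qed.

(** Partial sums of the projections as single endomorphisms: the module axioms speak of binary sums
    only, so the identity is split one summand at a time. *)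
Definition trunc (s : seq comp) (u : P) : P := exist _ _ (trunc_proof s u).

Lemma trunc_isEnd s : isEnd (trunc s).
Proof.
split=> [u w|u h]; apply: Pt_eq => l /=; case: ifP => _ //.
- by rewrite addr0.
- by rewrite mul0r.
Qed.

Lemma comp_isEnd (phi psi : P -> P) : isEnd phi -> isEnd psi ->
  isEnd (fun u => phi (psi u)).
Proof.
by move=> [hD hM] [kD kM]; split=> *; rewrite ?kD ?kM ?hD ?hM.
Qed.

Variable y : comp -> H.
Hypothesis xyx : forall l, x l * y l * x l = x l.

Lemma xyM (l : comp) (u : P) : x l * (y l * sval u l) = sval u l.
Proof. by case: (svalP u l) => h ->; rewrite !mulrA xyx. Qed.

Local Notation e l := (Eend l l (y l)).

(** [x l * y l] is an idempotent fixing every element of [x l * H], so [e l] is the projection to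
    the summand [l]. *)
Lemma e_val l u nu : sval (e l u) nu = if nu == l then sval u l else 0.
Proof. by rewrite /= xyM. Qed.

Lemma Eend_comp nu mu lam g h :
  (fun u => Eend nu mu g (Eend mu lam h u)) = Eend nu lam (g * x mu * h).
Proof.
apply: funext => u; apply: Pt_eq => l /=; case: eqP => // _.
by rewrite eqxx !mulrA.
Qed.

Lemma e_Eend mu lam g : (fun u => e mu (Eend mu lam g u)) = Eend mu lam g.
Proof.
by apply: funext => u; apply: Pt_eq => l; rewrite e_val /= eqxx.
Qed.

Lemma delta_proof (lam : comp) : forall l, exists h,
  (fun nu : comp => if nu == lam then x lam else 0) l = x l * h.
Proof.
move=> l /=; case: eqP => [->|_]; first by exists 1; rewrite mulr1.
by exists 0; rewrite mulr0.
Qed.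

(** The summand [lam] is generated by [delta], and [u lam = x lam * (y lam * u lam)]. Hence [phi] is
    determined there by the component [x mu * h] of [phi delta], and the factor [y lam] turns this
    into left multiplication by [x mu * (h * y lam)]. *)
Lemma corner_end (phi : P -> P) mu lam : isEnd phi ->
  exists g, (fun u => e mu (phi (e lam u))) = Eend mu lam g.
Proof.
case=> _ phiM; pose delta : P := exist _ _ (delta_proof lam).
have [h Eh] := svalP (phi delta) mu; exists (h * y lam).
apply: funext => u; apply: Pt_eq => l; rewrite e_val /=; case: eqP => // _.
have -> : e lam u = Pmulr delta (y lam * sval u lam).
  by apply: Pt_eq => nu /=; case: eqP => // _; rewrite mul0r.
by rewrite phiM /= Eh !mulrA.
Qed.

Variables (M : lmodType F) (act : (P -> P) -> M -> M).
Hypotheses (actM : is_Smod act) (simpleM : is_Ssimple act).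

Lemma act_id m : act id m = m.
Proof. by case: actM. Qed.
Lemma act_comp phi psi m : isEnd phi -> isEnd psi ->
  act (fun u => phi (psi u)) m = act phi (act psi m).
Proof. by case: actM => _ _ + _ _ hphi hpsi; apply. Qed.
Lemma act_add phi psi m : isEnd phi -> isEnd psi ->
  act (fun u => Padd (phi u) (psi u)) m = act phi m + act psi m.
Proof. by case: actM => _ _ _ + _ hphi hpsi; apply. Qed.
Lemma act_scale phi c m : isEnd phi ->
  act (fun u => Pmulr (phi u) c%:A) m = c *: act phi m.
Proof. by case: actM => _ _ _ _ + hphi; apply. Qed.
Lemma act_Eend_linear mu lam m a g h :
  act (Eend mu lam (a *: g + h)) m =
  a *: act (Eend mu lam g) m + act (Eend mu lam h) m.
Proof.
rewrite -act_scale; last exact: Eend_isEnd.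
have sE : isEnd (fun u => Pmulr (Eend mu lam g u) a%:A).
  split=> [u w|u k]; apply: Pt_eq => l /=; case: eqP => _.
  - by rewrite -mulrDl !mulrDr.
  - by rewrite mul0r addr0.
  - by rewrite -!mulrA [k * _]mulr_algr mulr_algl.
  - by rewrite !mul0r.
rewrite -act_add //; last exact: Eend_isEnd.
congr (act _ m); apply: funext => u; apply: Pt_eq => l /=; case: eqP => _.
  by rewrite mulrDl mulrDr -scalerAl mulr_algr -scalerAr.
by rewrite mul0r addr0.
Qed.

Lemma act_trunc s m : uniq s ->
  act (trunc s) m = \sum_(l <- s) act (e l) m.
Proof.
elim: s => [_|l s IH /= /andP[ls us]].
  rewrite big_nil -[RHS](scale0r (act (trunc [::]) m)).
  rewrite -act_scale; last exact: trunc_isEnd.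
  by congr (act _ m); apply: funext => u; apply: Pt_eq => nu /=; rewrite mul0r.
rewrite big_cons -IH // -act_add; [|exact: Eend_isEnd|exact: trunc_isEnd].
congr (act _ m); apply: funext => u; apply: Pt_eq => nu; rewrite [RHS]/= xyM.
rewrite /= inE; case: eqP => [->|_] /=; last by rewrite add0r.
by rewrite (negPf ls) addr0.
Qed.

Lemma act_decomp m : m = \sum_(l <- enum {: comp}) act (e l) m.
Proof.
rewrite -act_trunc ?enum_uniq // -[LHS]act_id; congr (act _ m).
by apply: funext => u; apply: Pt_eq => nu /=; rewrite mem_enum inE.
Qed.

Lemma act_transitive (m m' : M) : m != 0 -> exists2 phi, isEnd phi & m' = act phi m.
Proof.
move=> m0; pose N v := exists2 phi, isEnd phi & v = act phi m.
have [|N0|Nall] := simpleM.2 N.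
- split.
  + exists (trunc [::]); first exact: trunc_isEnd.
    by rewrite act_trunc // big_nil.
  + move=> u v [phi hphi ->] [psi hpsi ->].
    exists (fun u => Padd (phi u) (psi u)); last by rewrite act_add.
    case: hphi hpsi => [hD hM] [kD kM]; split=> *; apply: Pt_eq => l.
      by rewrite /= hD kD /= addrACA.
    by rewrite /= hM kM /= mulrDl.
  + move=> phi _ hphi [psi hpsi ->]; exists (fun u => phi (psi u)).
      exact: comp_isEnd.
    by rewrite (act_comp _ hphi hpsi).
- by case/eqP: m0; apply: N0; exists id => //; rewrite act_id.
- exact: Nall.
Qed.

(** By simplicity each vector is [act phi m], and cutting [phi] by the projections makes it a sum of
    vectors [act (Eend mu lam g) m]. Each of these is linear in [g] and vanishes on [K], so a finite
    family spanning [H] modulo [K], taken once for every [mu], spans [M]. *)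
Lemma findim_of_maximal_left_ideals :
  (forall K : H -> Prop, maximal_ideal K -> exists B, forall h, modspan K B h) ->
  findim M.
Proof.
move=> codim; have [m0 m0_neq0] := simpleM.1.
have [lam m_neq0] : exists lam, act (e lam) m0 != 0.
  apply/existsP; apply: contraNT m0_neq0; rewrite negb_exists => /forallP h.
  rewrite (act_decomp m0) big1 // => l _; apply/eqP.
  by have := h l; rewrite negbK.
set m := act (e lam) m0 in m_neq0.
have hE mu nu g : isEnd (Eend mu nu g) by apply: Eend_isEnd.
have em : act (e lam) m = m by rewrite /m -act_comp // e_Eend.
(* The annihilator of the generator of the simple [H]-module that corresponds
   to [M] under idempotent truncation. *)
pose K h := forall mu g, act (Eend mu lam (g * h)) m = 0.
have maxK : maximal_ideal K.
  split.
  - have E0 mu : act (Eend mu lam 0) m = 0.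
      have := act_Eend_linear mu lam m (-1) 0 0.
      by rewrite !scaleN1r oppr0 addr0 addNr.
    split=> [mu g|a u v Ku Kv mu g]; first by rewrite mulr0.
    have := act_Eend_linear mu lam m 1 (g * (a * u)) (g * v).
    by rewrite !scale1r -mulrDr mulrA Ku Kv addr0.
  - by move=> /(_ lam (y lam)); rewrite mulr1 em => /eqP; rewrite (negPf m_neq0).
  - move=> h /existsNP[mu /existsNP[g /eqP h_neq0]].
    have [phi hphi Em] := act_transitive m h_neq0.
    have [g' Eg'] := corner_end lam mu hphi.
    (* [g'] is the component of [phi] that leads the nonzero vector back to [m], so
       [Eend lam lam (g' * x mu * (g * h))] fixes [m]. Composing with [Eend nu lam k] inserts the
       extra factor [x lam]. *)
    exists (x lam * (g' * x mu * g)) => nu k.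
    have E : m = act (Eend lam lam (g' * x mu * (g * h))) m.
      rewrite -Eend_comp act_comp // -Eg' act_comp //; last exact: comp_isEnd.
      by rewrite act_comp // -[act (e mu) _]act_comp // e_Eend -Em em.
    have := act_Eend_linear nu lam m (-1) (k * x lam * (g' * x mu * (g * h))) k.
    rewrite -[in X in _ = X]Eend_comp act_comp // -E !scaleN1r addNr => <-.
    congr (act (Eend _ _ _) m).
    by rewrite mulrBr mulr1 addrC !mulrA.
have [B HB] := codim K maxK.
pose BM := flatten [seq [seq act (Eend mu lam b) m | b <- B] | mu <- enum {: comp}].
apply: (@modspan_findim _ _ BM) => v.
have [phi hphi ->] := act_transitive v m_neq0.
rewrite [act phi m]act_decomp /BM.
have s0 : subspace (fun v : M => v = 0).
  by split=> // a u w -> ->; rewrite scaler0 addr0.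
elim: (enum _) => [|mu s IH]; first by rewrite big_nil.
rewrite big_cons /=; apply: modspan_cat => //.
have [g Eg] := corner_end mu lam hphi.
have -> : act (e mu) (act phi m) = act (Eend mu lam g) m.
  rewrite -{1}em -Eg (act_comp _ (hE mu mu _) (comp_isEnd hphi (hE lam lam _))).
  by rewrite (act_comp _ hphi (hE lam lam _)).
apply: (@modspan_linear _ _ _ K _ (fun b => act (Eend mu lam b) m)) (HB g).
  by move=> a u u'; rewrite act_Eend_linear.
by move=> u /(_ mu 1); rewrite mul1r.
Qed.

End SchurReduction.

(** * Reduced words and the elements [T_w] *)

Section PermLength.
Variable r : nat.
Implicit Types (w : 'S_r) (i j : 'I_r).

Lemma val_ordS i : (i.+1 < r)%N -> ordS i = i.+1 :> nat.
Proof. by move=> lti /=; rewrite modn_small. Qed.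

(** Swapping two neighbours reverses the order of no other pair. The bound on [i] excludes the
    affine index, at which [ordS] wraps around. *)
Lemma sref_lt i (u v : 'I_r) : (i.+1 < r)%N -> u != v ->
    ~~ ((u == i) && (v == ordS i)) -> ~~ ((u == ordS i) && (v == i)) ->
  (sref i u < sref i v)%N = (u < v)%N.
Proof.
move=> /val_ordS; rewrite -!val_eqE /sref; move: (ordS i) => i1 /= Ei.
case: tpermP => [->|->|/eqP + /eqP]; case: tpermP => [->|->|/eqP + /eqP];
  rewrite -?val_eqE /=; lia.
Qed.

Lemma srefK i : (sref i * sref i = 1)%g.
Proof. exact: tperm2. Qed.

Lemma perm_len1 : perm_len (1%g : 'S_r) = 0%N.
Proof.
apply/eqP; rewrite cards_eq0; apply/eqP/setP => -[a b]; rewrite !inE !perm1 /=.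
lia.
Qed.

(** Permutations are composed from left to right, so [w * sref i] exchanges two neighbouring values
    of [w]; their positions are given by [w^-1]. *)
Definition descent w i : bool := ((w^-1)%g (ordS i) < (w^-1)%g i)%N.

(** The positions [a < b] of the two exchanged values form the only new inversion. *)
Lemma perm_len_up w i : (i.+1 < r)%N -> ~~ descent w i ->
  perm_len (w * sref i)%g = (perm_len w).+1.
Proof.
move=> lti ndes; rewrite /perm_len.
pose a := (w^-1)%g i; pose b := (w^-1)%g (ordS i).
have wa : w a = i by rewrite permKV.
have wb : w b = ordS i by rewrite permKV.
have Ea c : (w c == i) = (c == a) by rewrite -wa (inj_eq perm_inj).
have Eb c : (w c == ordS i) = (c == b) by rewrite -wb (inj_eq perm_inj).
have iS : i != ordS i by rewrite -val_eqE /= modn_small //; lia.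
have ltab : (a < b)%N.
  rewrite ltn_neqAle leqNgt ndes andbT val_eqE.
  by apply: contraNneq iS => eab; rewrite -wb -eab wa.
rewrite (_ : [set p | _] = (a, b) |: [set p : 'I_r * 'I_r |
    (p.1 < p.2)%N && (w p.2 < w p.1)%N]); last first.
  apply/setP => -[c d]; rewrite !inE /= !permM xpair_eqE.
  have [/andP[/eqP-> /eqP->]|ncd] := boolP ((c == a) && (d == b)).
    by rewrite ltab wa wb /sref tpermL tpermR val_ordS //= ltnSn.
  have [ltcd|//] := boolP (c < d)%N.
  rewrite sref_lt //.
  - by apply: contraTneq ltcd => /perm_inj ->; rewrite ltnn.
  - rewrite Ea Eb; apply: contraTN ltcd.
    by case/andP=> /eqP-> /eqP->; lia.
  - by rewrite Ea Eb andbC.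
rewrite cardsU1 !inE /= wa wb val_ordS //.
by rewrite (ltnNge i.+1) leqnSn andbF.
Qed.

Lemma invMsref w i (p : 'I_r) : ((w * sref i)^-1)%g p = (w^-1)%g (sref i p).
Proof. by rewrite invMg permM /sref tpermV. Qed.

Lemma descentM w i : (i.+1 < r)%N -> descent (w * sref i)%g i = ~~ descent w i.
Proof.
move=> lti; rewrite /descent !invMsref /sref tpermL tpermR -leqNgt ltn_neqAle.
rewrite val_eqE (inj_eq perm_inj) andb_idl // => _.
by rewrite -val_eqE /= modn_small //; lia.
Qed.

Lemma perm_len_down w i : (i.+1 < r)%N -> descent w i ->
  perm_len w = (perm_len (w * sref i)%g).+1.
Proof.
move=> lti di; rewrite -[in LHS](mulgK (sref i) w) /sref tpermV.
by apply: perm_len_up => //; rewrite -/(sref i) descentM // di.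
Qed.

(** Without descents [w^-1] is strictly increasing, and comparison with the endpoints 0 and [r.-1]
    pins down each value. *)
Lemma no_descent_id w :
  (forall i, (i.+1 < r)%N -> ~~ descent w i) -> w = 1%g.
Proof.
move=> nd.
have mono k (i j : 'I_r) : j = (i + k)%N :> nat ->
    ((w^-1)%g i + k <= (w^-1)%g j)%N.
  elim: k j => [|k IH] j Ej.
    by rewrite addn0 (_ : j = i) //; apply: val_inj; rewrite /= Ej addn0.
  have ltj : (i + k < r)%N by have := ltn_ord j; lia.
  have ltj1 : ((Ordinal ltj).+1 < r)%N by have := ltn_ord j; rewrite /=; lia.
  have Sj : ordS (Ordinal ltj) = j by apply: val_inj; rewrite /= modn_small // Ej addnS.
  have := IH (Ordinal ltj) erefl; have := nd _ ltj1.
  rewrite /descent Sj -leqNgt.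
  have : (w^-1)%g (Ordinal ltj) != (w^-1)%g j.
    rewrite (inj_eq perm_inj) -val_eqE /=; lia.
  rewrite -val_eqE /=; lia.
apply: invg_inj; rewrite invg1; apply/permP => i; rewrite perm1; apply: val_inj.
have ltr := ltn_ord i.
have lt0 : (0 < r)%N by lia.
have ltm : (r.-1 < r)%N by lia.
have := mono i (Ordinal lt0) i (esym (add0n _)).
have Er : r.-1 = (i + (r.-1 - i))%N by lia.
have := mono _ i (Ordinal ltm) Er; rewrite /=.
have := ltn_ord ((w^-1)%g (Ordinal ltm)); have := ltn_ord ((w^-1)%g i).
move: (nat_of_ord ((w^-1)%g i))
  (nat_of_ord ((w^-1)%g (Ordinal ltm)))
  (nat_of_ord ((w^-1)%g (Ordinal lt0))).
move: (nat_of_ord i) ltr Er => k ltr Er a b c; lia.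
Qed.

Lemma redword_rcons w t i :
  redword w (rcons t i) = (i.+1 < r)%N && redword (w * sref i)%g t.
Proof.
rewrite /redword all_rcons -andbA; congr (_ && (_ && _)).
by rewrite -cats1 big_cat big_seq1 /=; apply/eqP/eqP => [<-|->];
  rewrite -mulgA srefK mulg1.
Qed.

Lemma perm_len_le_size w t : redword w t -> (perm_len w <= size t)%N.
Proof.
elim/last_ind: t w => [|t i IH] w.
  by rewrite /redword /= big_nil => /eqP <-; rewrite perm_len1.
rewrite redword_rcons size_rcons => /andP[lti /IH].
have [di|nd] := boolP (descent w i); first by rewrite (perm_len_down lti di); lia.
by rewrite perm_len_up //; lia.
Qed.

Lemma reduced_rcons w t i :
    redword w (rcons t i) -> size (rcons t i) = perm_len w ->
  [/\ (i.+1 < r)%N, descent w i, redword (w * sref i)%g t &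
      size t = perm_len (w * sref i)%g].
Proof.
rewrite redword_rcons size_rcons => /andP[lti rt] sz.
have le := perm_len_le_size rt.
have di : descent w i.
  by apply: contraTT (le) => nd; rewrite perm_len_up //; lia.
by split=> //; have := perm_len_down lti di; lia.
Qed.

Lemma reduced_exists w : exists2 t, redword w t & size t = perm_len w.
Proof.
elim: (perm_len w) {-2}w (erefl (perm_len w)) => [|l IH] {}w Ew.
  exists [::] => //; rewrite /redword /= big_nil eq_sym; apply/eqP/no_descent_id.
  by move=> i lti; apply/negP => /(perm_len_down lti); rewrite Ew.
have [[i lti di]|nd] := pselect (exists2 i : 'I_r, (i.+1 < r)%N & descent w i).
  have Ei := perm_len_down lti di.
  have [t rt st] := IH (w * sref i)%g (succn_inj (etrans (esym Ei) Ew)).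
  exists (rcons t i); last by rewrite size_rcons st -Ei.
  by rewrite redword_rcons lti.
have w1 : w = 1%g.
  by apply: no_descent_id => i lti; apply/negP => di; apply: nd; exists i.
by move: Ew; rewrite w1 perm_len1.
Qed.

End PermLength.

(** * Matsumoto's theorem and the multiplication rules for [T_w] *)

Section Matsumoto.
Variable r : nat.
Implicit Types (w : 'S_r) (i j : 'I_r).

Definition reduced w (t : seq 'I_r) := redword w t /\ size t = perm_len w.

Lemma reduced_rconsE w t i : (i.+1 < r)%N -> descent w i ->
  reduced (w * sref i)%g t -> reduced w (rcons t i).
Proof.
move=> lti di [rt st]; split; first by rewrite redword_rcons lti.
by rewrite size_rcons st -perm_len_down.
Qed.

Lemma sref_fix i (p : 'I_r) : (i.+1 < r)%N -> p != i :> nat -> p != i.+1 :> nat ->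
  sref i p = p.
Proof.
move=> lti pi pSi; rewrite /sref tpermD // -val_eqE /= ?modn_small // eq_sym //.
Qed.

Lemma sref_comm i j : (i.+1 < r)%N -> (j.+1 < r)%N -> (i.+1 < j)%N ->
  (sref i * sref j = sref j * sref i)%g.
Proof.
move=> lti ltj ij; have Ej := val_ordS ltj.
rewrite (conjgC (sref i)) {2}/sref tpermJ -/(sref j); congr (_ * tperm _ _)%g.
  by rewrite sref_fix //; lia.
by rewrite sref_fix // val_ordS //; lia.
Qed.

Lemma sref_braid i j : (i.+1 < r)%N -> (j.+1 < r)%N -> j = i.+1 :> nat ->
  (sref i * sref j * sref i = sref j * sref i * sref j)%g.
Proof.
move=> lti ltj ij.
have -> : (sref i * sref j * sref i = sref j ^ sref i)%g.
  by rewrite conjgE {1 2}/sref tpermV mulgA.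
have -> : (sref j * sref i * sref j = sref i ^ sref j)%g.
  by rewrite conjgE {1 2}/sref tpermV mulgA.
have Ei : ordS i = j by apply: val_inj; rewrite /= modn_small // ij.
have Sj := val_ordS ltj.
have si_Sj : sref i (ordS j) = ordS j by apply: sref_fix => //; lia.
have sj_i : sref j i = i by apply: sref_fix => //; lia.
transitivity (tperm i (ordS j)).
  by rewrite {1}/sref tpermJ si_Sj {1}/sref Ei tpermR.
by rewrite {1}/sref tpermJ sj_i Ei {1}/sref tpermL.
Qed.

Variables (F : fieldType) (H : algType F) (T : 'I_r -> H).
Hypothesis Tcomm : forall i j, (i.+1 < r)%N -> (j.+1 < r)%N -> (i.+1 < j)%N ->
  T i * T j = T j * T i.
Hypothesis Tbraid : forall i j, (i.+1 < r)%N -> (j.+1 < r)%N ->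
  j = i.+1 :> nat -> T i * T j * T i = T j * T i * T j.

Local Notation Tword t := (\prod_(k <- t) T k).

Lemma Tword_rcons t i : Tword (rcons t i) = Tword t * T i.
Proof. by rewrite -cats1 big_cat big_seq1. Qed.

(** An element with descents [i] and [j] ends in the longest element of the subgroup these two
    generate. Both reduced words are therefore chosen with a common prefix [c], and a single
    commutation or braid relation compares them. *)
Lemma reduced_two_descents w i j :
    (i.+1 < r)%N -> (j.+1 < r)%N -> (i < j)%N -> descent w i -> descent w j ->
  exists a b, [/\ reduced (w * sref i)%g a, reduced (w * sref j)%g b &
    Tword a * T i = Tword b * T j].
Proof.
move=> lti ltj ij di dj.
have Ei := val_ordS lti; have Ej := val_ordS ltj.
have [ij2|] := ltnP i.+1 j.
  have [c rc sc] := reduced_exists (w * sref i * sref j)%g.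
  exists (rcons c j), (rcons c i); split.
  - apply: reduced_rconsE => //; rewrite /descent !invMsref !(sref_fix lti) //; lia.
  - apply: reduced_rconsE => //; last by rewrite -mulgA -(sref_comm lti ltj) // mulgA.
    rewrite /descent !invMsref !(sref_fix ltj) //; lia.
  - by rewrite !Tword_rcons -!mulrA (Tcomm lti ltj).
rewrite leq_eqVlt ltnS leqNgt ij orbF => /eqP Eij.
have SiE : ordS i = j by apply: val_inj; rewrite /= modn_small // Eij.
have si_i : sref i i = j by rewrite /sref tpermL.
have si_j : sref i j = i by rewrite /sref -SiE tpermR.
have sj_j : sref j j = ordS j by rewrite /sref tpermL.
have sj_Sj : sref j (ordS j) = j by rewrite /sref tpermR.
have si_Sj : sref i (ordS j) = ordS j by apply: sref_fix => //; lia.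
have sj_i : sref j i = i by apply: sref_fix => //; lia.
move: di dj; rewrite /descent SiE => di dj.
have [c rc sc] := reduced_exists (w * sref i * sref j * sref i)%g.
have Ew : (w * sref j * sref i * sref j = w * sref i * sref j * sref i)%g.
  by rewrite -!mulgA !(mulgA (sref _)) (sref_braid lti ltj).
exists (rcons (rcons c i) j), (rcons (rcons c j) i); split.
- apply: reduced_rconsE => //; first by rewrite /descent !invMsref si_Sj si_j; lia.
  apply: reduced_rconsE => //.
  by rewrite /descent !invMsref SiE sj_j sj_i si_Sj si_i.
- apply: reduced_rconsE => //; first by rewrite /descent !invMsref SiE sj_j sj_i; lia.
  apply: reduced_rconsE => //; last by rewrite Ew.
  by rewrite /descent !invMsref si_Sj sj_Sj si_j sj_i.
- by rewrite !Tword_rcons -!mulrA !(mulrA (T _)) (Tbraid lti ltj).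
Qed.

(** [Tw] picks an arbitrary reduced word, so its value must not depend on the choice. If the last
    letters differ, both words are compared by induction with the pair of words supplied by
    [reduced_two_descents]. *)
Lemma Tword_unique w t t' : reduced w t -> reduced w t' -> Tword t = Tword t'.
Proof.
elim: {w}(perm_len w) {-2}w (erefl (perm_len w)) t t' => [|l IH] w Ew t t'.
  by move=> [_]; rewrite Ew => /size0nil-> [_]; rewrite Ew => /size0nil->.
elim/last_ind: t => [[_ st]|t i _]; first by rewrite Ew in st.
elim/last_ind: t' => [_ [_ st]|t' j _]; first by rewrite Ew in st.
move=> [rt st] [rt' st'].
have [lti di rti sti] := reduced_rcons rt st.
have [ltj dj rtj stj] := reduced_rcons rt' st'.
have lw (k : 'I_r) : (k.+1 < r)%N -> descent w k -> perm_len (w * sref k)%g = l.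
  by move=> ltk /(perm_len_down ltk); rewrite Ew => -[].
rewrite !Tword_rcons.
have [Eij|] := eqVneq i j.
  by rewrite -Eij in rtj stj *; rewrite (IH _ (lw _ lti di) t t').
rewrite -val_eqE neq_ltn => /orP[ij|ji].
  have [a [b [ra rb Eab]]] := reduced_two_descents lti ltj ij di dj.
  by rewrite (IH _ (lw _ lti di) t a) // (IH _ (lw _ ltj dj) t' b).
have [a [b [ra rb Eab]]] := reduced_two_descents ltj lti ji dj di.
by rewrite (IH _ (lw _ lti di) t b) // (IH _ (lw _ ltj dj) t' a).
Qed.

Lemma Tw_reduced w t : reduced w t -> Tw T w = Tword t.
Proof.
move=> rt; rewrite /Tw; case: pickP => [t' rt'|none].
  by apply: (@Tword_unique w) => //; split=> //; rewrite size_tuple.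
case: rt => rt /eqP st; by have := none (Tuple st); rewrite /= rt.
Qed.

Lemma Tw1 : Tw T 1%g = 1.
Proof.
rewrite (@Tw_reduced _ [::]) ?big_nil //.
by split; rewrite ?perm_len1 // /redword /= big_nil.
Qed.

Lemma Tw_descent w i : (i.+1 < r)%N -> descent w i ->
  Tw T w = Tw T (w * sref i)%g * T i.
Proof.
move=> lti di; have [t rt st] := reduced_exists (w * sref i)%g.
rewrite (Tw_reduced (conj rt st)) -Tword_rcons; apply: Tw_reduced.
exact: reduced_rconsE.
Qed.

Lemma Tw_up w i : (i.+1 < r)%N -> ~~ descent w i ->
  Tw T w * T i = Tw T (w * sref i)%g.
Proof.
by move=> lti nd; rewrite [RHS](@Tw_descent _ i) ?descentM // -mulgA srefK mulg1.
Qed.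

Variable q : F.
Hypothesis Tquad : forall i, T i * T i = (q - 1) *: T i + q%:A.

Lemma Tw_down w i : (i.+1 < r)%N -> descent w i ->
  Tw T w * T i = (q - 1) *: Tw T w + q *: Tw T (w * sref i)%g.
Proof.
move=> lti di; rewrite !(Tw_descent lti di) -mulrA Tquad mulrDr -scalerAr.
by rewrite mulr_algr.
Qed.

End Matsumoto.

(** * Regularity of [x_lambda] *)

Section Symmetrizer.
Variables (F : fieldType) (H : algType F) (q : F) (N : nat) (t : nat -> H).
Hypothesis tquad : forall i, (i < N)%N -> t i * t i = (q - 1) *: t i + q%:A.
Hypothesis tcomm : forall i j, (i.+1 < j)%N -> (j < N)%N -> t i * t j = t j * t i.
Hypothesis tbraid : forall i, (i.+1 < N)%N ->
  t i * t i.+1 * t i = t i.+1 * t i * t i.+1.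
Variable J : nat -> bool.

(* [cosum k] is the sum of [T_d] over the minimal coset representatives [d] of
   the subgroup generated by the [s_i], [J i], [i < k.-1] in the one generated
   by those with [i < k]. *)
Fixpoint cosum k :=
  if k is k'.+1 then if J k' then 1 + cosum k' * t k' else 1 else 1.

(** Formally the sum of [T_w] over the parabolic subgroup of [J], factored through coset sums so
    that induction on [k] replaces sums over permutations. *)
Fixpoint symmetrizer k := if k is k'.+1 then cosum k * symmetrizer k' else 1.

Lemma cosum_comm k m : (k < m)%N -> (m < N)%N -> t m * cosum k = cosum k * t m.
Proof.
elim: k => [|k IH] ltkm ltm /=; first by rewrite mulr1 mul1r.
case: (J k); last by rewrite mulr1 mul1r.
by rewrite mulrDl mulrDr mulr1 mul1r mulrA IH ?(ltnW ltkm) // -!mulrA -tcomm.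
Qed.

(** The quadratic relation says that [t i - q] kills [1 + t i]. *)
Lemma quad_eigen i v : (i < N)%N ->
  t i * (v + t i * v) = q *: (v + t i * v).
Proof.
move=> lti; rewrite mulrDr mulrA tquad // mulrDl -scalerAl mulr_algl scalerDr.
by rewrite scalerBl scale1r addrA [t i * v + _]addrC subrK addrC.
Qed.

(** Split [cosum k.+2 * v] as [v + cosum k.+1 * (t k.+1 * v)]. For [i <= k] induction applies to
    [t k.+1 * v], because [t k.+1] commutes with each [t m], [m < k]. For [i = k.+1] the quadratic
    relation handles [v + t k.+1 * v], and the braid relation moves a generator onto [v] in the
    other terms. *)
Lemma cosum_eigen k v : (k < N)%N ->
    (forall m, (m < k)%N -> J m -> t m * v = q *: v) ->
  forall i, (i <= k)%N -> J i ->
  t i * (cosum k.+1 * v) = q *: (cosum k.+1 * v).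
Proof.
elim: k v => [|k IH] v ltk hv i lei Ji /=.
  rewrite leqn0 in lei; rewrite (eqP lei) in Ji *; rewrite Ji !mul1r mulrDl mul1r.
  exact: quad_eigen.
case Jk: (J k.+1); last first.
  rewrite mul1r; apply: hv => //; rewrite ltn_neqAle lei andbT.
  by apply: contraTneq Ji => ->; rewrite Jk.
have [ltik|] := ltnP i k.+1.
  have hw := IH (t k.+1 * v) (ltnW ltk) _ i ltik Ji.
  rewrite mulrDl mul1r mulrDr hv // -[cosum k.+1 * _ * _]mulrA hw ?scalerDr //.
  by move=> m ltm Jm; rewrite mulrA tcomm // -mulrA hv ?scalerAr // (ltn_trans ltm).
move=> gei; have -> : i = k.+1 by lia.
rewrite /=; case Jk': (J k); last first.
  by rewrite mul1r mulrDl mul1r quad_eigen.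
rewrite !mulrDl !mul1r addrA mulrDr quad_eigen // [RHS]scalerDr; congr (_ + _).
rewrite -!mulrA mulrA cosum_comm // -mulrA.
rewrite (mulrA (t k.+1) (t k)) (mulrA (_ * _)) -tbraid //.
by rewrite -!mulrA hv // !scalerAr.
Qed.

Lemma symmetrizer_eigen k : (k <= N)%N ->
  forall i, (i < k)%N -> J i -> t i * symmetrizer k = q *: symmetrizer k.
Proof.
elim: k => // k IH ltk i lei Ji; apply: cosum_eigen => //.
by move=> m ltm Jm; apply: IH => //; apply: ltnW.
Qed.

Fixpoint cosum_val k : F :=
  if k is k'.+1 then if J k' then 1 + cosum_val k' * q else 1 else 1.

Hypothesis q_not_root : forall k, (0 < k)%N -> q ^+ k != 1.

(** The value is a q-integer [1 + q + ... + q ^ b]; multiplied by [q - 1] it becomes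
    [q ^ (b + 1) - 1]. This is where the hypothesis on roots of unity enters. *)
Lemma cosum_val_neq0 k : cosum_val k != 0.
Proof.
suff [b Eb] : exists b, (q - 1) * cosum_val k = q ^+ b.+1 - 1.
  apply: contraNneq (q_not_root (ltn0Sn b)) => E.
  by rewrite -subr_eq0 -Eb E mulr0.
elim: k => [|k [b Eb]] /=; first by exists 0%N; rewrite mulr1.
case: (J k); last by exists 0%N; rewrite mulr1.
exists b.+1; rewrite mulrDr mulr1 mulrA Eb mulrBl mul1r -exprSr.
by rewrite addrC addrA subrK.
Qed.

(** The scalar [c] is the Poincare polynomial of the parabolic subgroup at [q], obtained as a
    product of q-integers. *)
Lemma right_eigen_symmetrizer (x : H) :
    (forall i, (i < N)%N -> J i -> x * t i = q *: x) ->
  exists2 c, c != 0 & x * symmetrizer N = c *: x.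
Proof.
move=> hx.
have hc k : (k <= N)%N -> x * cosum k = cosum_val k *: x.
  elim: k => [|k IH] lek /=; first by rewrite mulr1 scale1r.
  case Jk: (J k); last by rewrite mulr1 scale1r.
  rewrite mulrDr mulr1 mulrA IH ?(ltnW lek) // -scalerAl hx //.
  by rewrite scalerA scalerDl scale1r.
elim: {-2}N (leqnn N) => [|k IH] lek.
  by exists 1; rewrite ?oner_neq0 // mulr1 scale1r.
have [c c0 Ec] := IH (ltnW lek).
exists (cosum_val k.+1 * c); first by rewrite mulf_neq0 ?cosum_val_neq0.
by rewrite [symmetrizer _]/= -/(cosum k.+1) mulrA hc // -scalerAl Ec scalerA.
Qed.

End Symmetrizer.

Section Regularity.
Variables (F : fieldType) (H : algType F) (q : F) (n r : nat) (T : 'I_r -> H).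
Hypothesis Tquad : forall i, T i * T i = (q - 1) *: T i + q%:A.
Hypothesis Tcomm : forall i j : 'I_r, (i.+1 < r)%N -> (j.+1 < r)%N ->
  (i.+1 < j)%N -> T i * T j = T j * T i.
Hypothesis Tbraid : forall i j : 'I_r, (i.+1 < r)%N -> (j.+1 < r)%N ->
  j = i.+1 :> nat -> T i * T j * T i = T j * T i * T j.
Hypothesis q_not_root : forall k, (0 < k)%N -> q ^+ k != 1.
Variable l : comp_of n r.

Local Notation blkl p := (blk (val l) p).
Local Notation same_block i := (blkl i == blkl (ordS i)).

Lemma blk_mono (p p' : 'I_r) : (p <= p')%N -> (blkl p <= blkl p')%N.
Proof.
by move=> le; apply/subset_leq_card/fintype.subsetP => k; rewrite !inE => /leq_trans; apply.
Qed.

Lemma blk_sref (i p : 'I_r) : same_block i -> blkl (sref i p) = blkl p.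
Proof. by move=> /eqP E; rewrite /sref; case: tpermP => [->|->|]. Qed.

Lemma young_sref (w : 'S_r) (i : 'I_r) : same_block i ->
  ((w * sref i)%g \in young l) = (w \in young l).
Proof.
by move=> hi; rewrite !inE; apply: eq_forallb => p; rewrite permM blk_sref.
Qed.

(** [w] preserves blocks and block numbers are monotone, so a descent forces the two neighbouring
    values into one block. *)
Lemma young_descent (w : 'S_r) (i : 'I_r) : (i.+1 < r)%N ->
  w \in young l -> descent w i -> same_block i.
Proof.
rewrite inE => lti /forallP hw di.
have hV p : blkl ((w^-1)%g p) = blkl p.
  by have /eqP := hw ((w^-1)%g p); rewrite permKV.
rewrite eqn_leq blk_mono ?val_ordS //= -(hV (ordS i)) -(hV i).
by apply: blk_mono; apply: ltnW.
Qed.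

(** Right multiplication by [sref i] exchanges the elements of the Young subgroup with and without
    the descent [i], so the two halves of the sum trade places. *)
Lemma xl_eigen (i : 'I_r) : (i.+1 < r)%N -> same_block i ->
  xl T l * T i = q *: xl T l.
Proof.
move=> lti hi; rewrite /xl mulr_suml.
rewrite (bigID (fun w => descent w i)) /= [in RHS](bigID (fun w => descent w i)) /=.
rewrite (eq_bigr (fun w => (q - 1) *: Tw T w + q *: Tw T (w * sref i)%g));
  last by move=> w /andP[_ di]; apply: Tw_down.
rewrite [X in _ + X](eq_bigr (fun w => Tw T (w * sref i)%g));
  last by move=> w /andP[_ nd]; apply: Tw_up.
rewrite big_split /= -!scaler_sumr.
have -> : \sum_(w in young l | descent w i) Tw T (w * sref i)%g =
    \sum_(w in young l | ~~ descent w i) Tw T w.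
  rewrite [RHS](reindex_inj (mulIg (sref i))) /=; apply: eq_bigl => w.
  by rewrite young_sref // descentM // negbK.
have -> : \sum_(w in young l | ~~ descent w i) Tw T (w * sref i)%g =
    \sum_(w in young l | descent w i) Tw T w.
  rewrite [RHS](reindex_inj (mulIg (sref i))) /=; apply: eq_bigl => w.
  by rewrite young_sref // descentM.
by rewrite addrAC scalerBl scale1r subrK scalerDr.
Qed.

Lemma Tw_left_eigen (y : H) (w : 'S_r) : w \in young l ->
    (forall i : 'I_r, (i.+1 < r)%N -> same_block i -> T i * y = q *: y) ->
  exists c, Tw T w * y = c *: y.
Proof.
move=> + hy; elim: {w}(perm_len w) {-2}w (erefl (perm_len w)) => [|k IH] w Ew yw.
  have -> : w = 1%g.
    apply: no_descent_id => i lti; apply/negP => /(perm_len_down lti).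
    by rewrite Ew.
  by exists 1; rewrite Tw1 // mul1r scale1r.
have [[i lti di]|nd] := pselect (exists2 i : 'I_r, (i.+1 < r)%N & descent w i).
  have hi := young_descent lti yw di.
  have [||c Ec] := IH (w * sref i)%g.
  - by have := perm_len_down lti di; rewrite Ew => -[].
  - by rewrite young_sref.
  exists (q * c).
  by rewrite (Tw_descent Tcomm Tbraid lti di) -mulrA hy // -scalerAr Ec scalerA.
have w1 : w = 1%g.
  by apply: no_descent_id => i lti; apply/negP => di; apply: nd; exists i.
by move: Ew; rewrite w1 perm_len1.
Qed.

(** Evaluating [x * y] for the symmetrizer [y] from both sides gives [c *: x = P *: y] with [c]
    nonzero, whence [x * x = P *: x]. If [P] is zero, so is [x]; otherwise the inverse of [P] is the
    witness. *)
Lemma xl_regular : (0 < r)%N -> exists y, xl T l * y * xl T l = xl T l.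
Proof.
move=> r_gt0.
pose i0 := Ordinal r_gt0.
pose o (i : nat) : 'I_r := insubd i0 i.
have val_o i : (i < r)%N -> o i = i :> nat by move=> lti; rewrite /o val_insubd lti.
have lt_o i : (i < r.-1)%N -> ((o i).+1 < r)%N.
  by move=> lti; rewrite val_o; lia.
pose t i := T (o i).
pose J i := same_block (o i).
pose y := symmetrizer t J r.-1.
have ty i : (i < r.-1)%N -> J i -> t i * y = q *: y.
  apply: (@symmetrizer_eigen _ _ q r.-1) => // [j ltj|j k ltj ltk|j ltj].
  - exact: Tquad.
  - by apply: Tcomm; rewrite ?lt_o ?val_o; lia.
  - by apply: Tbraid; rewrite ?lt_o ?val_o; lia.
have [c c0 Ec] : exists2 c, c != 0 & xl T l * y = c *: xl T l.
  apply: right_eigen_symmetrizer q_not_root _ _ => i lti Ji.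
  by apply: xl_eigen => //; apply: lt_o.
have [P EP] : exists P, xl T l * y = P *: y.
  rewrite /xl mulr_suml; apply: (big_ind (fun h => exists P, h = P *: y)).
  - by exists 0; rewrite scale0r.
  - by move=> _ _ [a ->] [b ->]; exists (a + b); rewrite scalerDl.
  - move=> w yw; apply: Tw_left_eigen => // i lti hi.
    have Ei : o i = i by apply: val_inj; rewrite /= val_o // ltnW.
    by have := ty i; rewrite /t /J Ei; apply=> //; lia.
have Ex : xl T l = (P / c) *: y.
  by rewrite mulrC -scalerA -EP Ec scalerA mulVf // scale1r.
have xx : xl T l * xl T l = P *: xl T l.
  by rewrite {2}Ex -scalerAr Ec scalerA divfK.
have [P0|P0] := eqVneq P 0.
  by exists 0; rewrite Ex P0 mul0r scale0r mulr0.
by exists (P^-1)%:A; rewrite mulr_algr -scalerAl xx scalerA mulVf // scale1r.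
Qed.

End Regularity.

(** * Bernstein elements *)

Lemma comm_inverse (H : pzRingType) (x y y' : H) :
  y * y' = 1 -> y' * y = 1 -> x * y = y * x -> x * y' = y' * x.
Proof.
move=> yy' y'y xy; rewrite -[LHS]mul1r -y'y -!mulrA (mulrA y) -xy.
by rewrite -(mulrA x) yy' mulr1.
Qed.

Section Bernstein.
Variables (F : fieldType) (H : algType F) (q : F) (N' : nat) (t : nat -> H).
Local Notation N := N'.+1.
Variables (R Ri : H).
Hypothesis q0 : q != 0.
Hypothesis tquad : forall i, (i < N)%N -> t i * t i = (q - 1) *: t i + q%:A.
Hypothesis tcomm : forall i j, (i.+1 < j)%N -> (j < N)%N -> t i * t j = t j * t i.
Hypothesis tbraid : forall i, (i.+1 < N)%N ->
  t i * t i.+1 * t i = t i.+1 * t i * t i.+1.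
Hypotheses (RRi : R * Ri = 1) (RiR : Ri * R = 1).
Hypothesis Rt : forall i, (i < N)%N -> R * t i = t i.+1 * R.
Hypothesis RtN : R * t N = t 0 * R.

Definition tinv i : H := q^-1 *: (t i - (q - 1)%:A).
Local Notation u := tinv.

Lemma t_tinv i : (i < N)%N -> t i * u i = 1.
Proof.
move=> lti; rewrite -scalerAr mulrBr tquad // mulr_algr addrAC subrr add0r.
by rewrite scalerA mulVf // scale1r.
Qed.

Lemma tinv_t i : (i < N)%N -> u i * t i = 1.
Proof.
move=> lti; rewrite -scalerAl mulrBl tquad // mulr_algl addrAC subrr add0r.
by rewrite scalerA mulVf // scale1r.
Qed.

Lemma comm_tinv x i : (i < N)%N -> x * t i = t i * x -> x * u i = u i * x.
Proof. by move=> lti; apply: comm_inverse; [apply: t_tinv | apply: tinv_t]. Qed.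

Fixpoint desc_prod k := if k is k'.+1 then t k' * desc_prod k' else 1.
Fixpoint desc_prod_inv k := if k is k'.+1 then desc_prod_inv k' * u k' else 1.
(** The conjugate of [desc_prod k] by [R], which is also [desc_prod k.+1] without its last factor
    [t 0]. *)
Fixpoint desc_tail k := if k is k'.+1 then t k * desc_tail k' else 1.

Lemma desc_prodS k : desc_prod k.+1 = t k * desc_prod k. Proof. by []. Qed.
Lemma desc_prod_invS k : desc_prod_inv k.+1 = desc_prod_inv k * u k. Proof. by []. Qed.
Lemma desc_prod0 : desc_prod 0 = 1. Proof. by []. Qed.
Lemma desc_prod_inv0 : desc_prod_inv 0 = 1. Proof. by []. Qed.
Lemma desc_tail0 : desc_tail 0 = 1. Proof. by []. Qed.
Lemma desc_tailS k : desc_tail k.+1 = t k.+1 * desc_tail k. Proof. by []. Qed.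

Lemma desc_prodV k : (k <= N)%N -> desc_prod k * desc_prod_inv k = 1.
Proof.
elim: k => [|k IH] lek; first by rewrite desc_prod0 desc_prod_inv0 mulr1.
by rewrite desc_prodS desc_prod_invS mulrA -(mulrA (t k)) IH ?(ltnW lek) // mulr1 t_tinv.
Qed.

Lemma desc_prodVl k : (k <= N)%N -> desc_prod_inv k * desc_prod k = 1.
Proof.
elim: k => [|k IH] lek; first by rewrite desc_prod0 desc_prod_inv0 mulr1.
by rewrite desc_prodS desc_prod_invS mulrA -(mulrA (desc_prod_inv k))
  tinv_t // mulr1 IH ?(ltnW lek).
Qed.

Lemma desc_prod_comm k m : (k < m)%N -> (m < N)%N -> t m * desc_prod k = desc_prod k * t m.
Proof.
elim: k => [|k IH] ltkm ltm; first by rewrite desc_prod0 mulr1 mul1r.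
by rewrite desc_prodS -mulrA -IH ?(ltnW ltkm) // !mulrA (@tcomm k m).
Qed.

(** Conjugation by [desc_prod N] lowers the index of a generator and conjugation by [R] raises it;
    this is why [R * desc_prod N] commutes with [t j] for [0 < j < N]. *)
Lemma desc_prod_shift k i : (i.+1 < k)%N -> (k <= N)%N ->
  desc_prod k * t i.+1 = t i * desc_prod k.
Proof.
elim: k => // k IH; rewrite ltnS leq_eqVlt => /predU1P[<-|ltik] lek.
  by rewrite !desc_prodS -!mulrA -desc_prod_comm // !mulrA tbraid.
by rewrite desc_prodS -mulrA IH ?(ltnW lek) // !mulrA (@tcomm i k).
Qed.

Lemma desc_prod_recr k : desc_prod k.+1 = desc_tail k * t 0.
Proof.
by elim: k => [|k IH]; rewrite desc_prodS ?desc_prod0 ?desc_tail0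
  ?mulr1 ?mul1r // IH desc_tailS mulrA.
Qed.

Lemma desc_prod_mul_tail k : (k <= N')%N ->
  desc_prod N * desc_tail k = desc_prod k * desc_prod N.
Proof.
elim: k => [|k IH] lek; first by rewrite desc_prod0 desc_tail0 mulr1 mul1r.
by rewrite desc_tailS mulrA (@desc_prod_shift N) // (desc_prodS k) -!(mulrA (t k)) IH // ltnW.
Qed.

Lemma desc_tail_mul_R k : (k <= N')%N -> desc_tail k * R = R * desc_prod k.
Proof.
elim: k => [|k IH] lek; first by rewrite desc_prod0 desc_tail0 mulr1 mul1r.
by rewrite desc_tailS desc_prodS -mulrA IH ?(ltnW lek) // !mulrA Rt // ltnW.
Qed.

(* [t N] is the affine generator, [R] stands for [T_rho]. *)
Fixpoint bern i := if i is j.+1 then u j * bern j * u j else R * desc_prod N.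
Fixpoint bern_inv i := if i is j.+1 then t j * bern_inv j * t j else desc_prod_inv N * Ri.

Lemma bern0 : bern 0 = R * desc_prod N. Proof. by []. Qed.
Lemma bernS i : bern i.+1 = u i * bern i * u i. Proof. by []. Qed.
Lemma bern_inv0 : bern_inv 0 = desc_prod_inv N * Ri. Proof. by []. Qed.
Lemma bern_invS i : bern_inv i.+1 = t i * bern_inv i * t i. Proof. by []. Qed.

Lemma bernV i : (i <= N)%N -> bern i * bern_inv i = 1.
Proof.
elim: i => [_|i IH lti].
  by rewrite bern0 bern_inv0 mulrA -(mulrA R) desc_prodV // mulr1.
rewrite bernS bern_invS -!mulrA (mulrA (u i) (t i)) tinv_t // mul1r.
by rewrite (mulrA (bern i)) IH ?(ltnW lti) // mul1r tinv_t.
Qed.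

Lemma bernVl i : (i <= N)%N -> bern_inv i * bern i = 1.
Proof.
elim: i => [_|i IH lti].
  by rewrite bern0 bern_inv0 mulrA -(mulrA (desc_prod_inv N)) RiR mulr1 desc_prodVl.
rewrite bernS bern_invS -!mulrA (mulrA (t i) (u i)) t_tinv // mul1r.
by rewrite (mulrA (bern_inv i)) IH ?(ltnW lti) // mul1r t_tinv.
Qed.

Lemma bern_comm_gt i j : (i < j)%N -> (j < N)%N -> bern i * t j = t j * bern i.
Proof.
elim: i => [|i IH] ltij ltj.
  case: j ltij ltj => // j _ ltj.
  by rewrite bern0 -mulrA (@desc_prod_shift N) // mulrA Rt ?(ltnW ltj) // mulrA.
have tju : t j * u i = u i * t j by apply: comm_tinv; [lia | rewrite -(@tcomm i j)].
have := IH (ltnW ltij) ltj; rewrite bernS; move: (bern i) => x xt.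
by rewrite -(mulrA (u i * x)) -tju !mulrA -(mulrA (u i) x) xt !mulrA tju.
Qed.

Lemma tinv_braidr j : (j.+1 < N)%N -> t j * (u j.+1 * u j) = u j.+1 * u j * t j.+1.
Proof.
move=> ltj; have ltj' := ltnW ltj.
have tt : t j * t j.+1 * (u j.+1 * u j) = 1.
  by rewrite mulrA -(mulrA (t j)) t_tinv // mulr1 t_tinv.
have uu : u j.+1 * u j * (t j * t j.+1) = 1.
  by rewrite mulrA -(mulrA (u j.+1)) tinv_t // mulr1 tinv_t.
rewrite -[LHS]mul1r -uu -!(mulrA (u j.+1 * u j)); congr (_ * _).
by rewrite mulrA tbraid // -(mulrA (t j.+1) (t j)) -(mulrA (t j.+1)) tt mulr1.
Qed.

Lemma tinv_braidl j : (j.+1 < N)%N -> u j * u j.+1 * t j = t j.+1 * (u j * u j.+1).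
Proof.
move=> ltj; have ltj' := ltnW ltj.
have tt : t j.+1 * t j * (u j * u j.+1) = 1.
  by rewrite mulrA -(mulrA (t j.+1)) t_tinv // mulr1 t_tinv.
have uu : u j * u j.+1 * (t j.+1 * t j) = 1.
  by rewrite mulrA -(mulrA (u j)) tinv_t // mulr1 tinv_t.
rewrite -[LHS]mulr1 -tt !(mulrA _ (t j.+1 * t j)); congr (_ * _).
rewrite -(mulrA (u j * _)) (mulrA (t j)) tbraid //.
by rewrite !mulrA -(mulrA (u j * _)) uu mul1r.
Qed.

(** The essential case is [i = j.+2]: passing the inner [u j * u j.+1] turns [t j] into [t j.+1],
    which commutes with [bern j], and the outer factors turn it back. *)
Lemma bern_comm_lt i j : (j.+1 < i)%N -> (i <= N)%N -> bern i * t j = t j * bern i.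
Proof.
elim: i => // i IH; rewrite ltnS leq_eqVlt => /predU1P[<-|ltij] lei; last first.
  have tju : t j * u i = u i * t j by apply: comm_tinv; rewrite ?(@tcomm j i).
  have := IH ltij (ltnW lei); rewrite bernS; move: (bern i) => x xt.
  by rewrite -(mulrA (u i * x)) -tju !mulrA -(mulrA (u i) x) xt !mulrA tju.
have Xt := bern_comm_gt (ltnSn j) lei.
have -> : bern j.+2 = u j.+1 * u j * bern j * (u j * u j.+1) by rewrite !bernS !mulrA.
rewrite -mulrA tinv_braidl // mulrA -(mulrA (_ * u j)) Xt.
by rewrite !mulrA -(mulrA (t j)) tinv_braidr // !mulrA.
Qed.

(** The two products are [Q * Q] and [u 0 * Q * Q * t 0], so the claim is that [t 0] commutes with
    [Q * Q]. There [R * R] carries [t N'] through the affine generator [t N] to [t 0], by [Rt] and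
    [RtN]. *)
Lemma bern0_comm_bern1 : bern 0 * bern 1 = bern 1 * bern 0.
Proof.
pose Q := R * desc_tail N'.
have X0Q : bern 0 = Q * t 0 by rewrite bern0 desc_prod_recr mulrA.
have X1E : bern 1 = u 0 * Q.
  by rewrite bernS X0Q -!mulrA t_tinv // mulr1.
have ERE : Q * Q = R * R * (desc_prod N' * desc_tail N').
  by rewrite /Q -!mulrA (mulrA (desc_tail N')) desc_tail_mul_R // !mulrA.
have QQ : t 0 * (Q * Q) = Q * Q * t 0.
  rewrite ERE -(mulrA _ _ (t 0)) -(mulrA (desc_prod N'))
    -desc_prod_recr -desc_prod_mul_tail //.
  by rewrite 3!mulrA -RtN -(mulrA R) -Rt // !mulrA.
rewrite X0Q X1E -mulrA (mulrA (t 0)) t_tinv // mul1r.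
by rewrite -(mulrA (u 0)) (mulrA Q Q) -QQ (mulrA (u 0)) tinv_t // mul1r.
Qed.

Lemma bern_comm i j : (i < j)%N -> (j <= N)%N -> bern i * bern j = bern j * bern i.
Proof.
have X0 k : (k < N)%N -> bern 0 * bern k.+1 = bern k.+1 * bern 0.
  elim: k => [|k IH] ltk; first exact: bern0_comm_bern1.
  have Xu : bern 0 * u k.+1 = u k.+1 * bern 0 by apply/comm_tinv/bern_comm_gt.
  have := IH (ltnW ltk); rewrite (bernS k.+1); move: (bern k.+1) (bern 0) Xu => x y yu yx.
  by rewrite !mulrA yu -(mulrA _ y) yx -!mulrA yu.
elim: i j => [|i IH] [|j] // ltij lej; first exact: X0.
have Xu : bern j.+1 * u i = u i * bern j.+1.
  by apply: comm_tinv; [lia | apply: bern_comm_lt].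
have := IH j.+1 (ltnW ltij) lej; rewrite (bernS i); move: (bern i) (bern j.+1) Xu => x y yu xy.
by rewrite -(mulrA (u i * x)) -yu mulrA -(mulrA (u i) x) xy !mulrA yu.
Qed.

(** The inverses are included so that [Ri], like [R], is an element of the subalgebra up to a factor
    from the finite Hecke algebra. *)
Definition bern_gens := [seq bern i | i <- iota 0 N.+1] ++ [seq bern_inv i | i <- iota 0 N.+1].

Lemma bern_gens_comm : {in bern_gens &, forall x y, x * y = y * x}.
Proof.
have cX i j : (i <= N)%N -> (j <= N)%N -> bern i * bern j = bern j * bern i.
  by move=> lei lej; case: (ltngtP i j) => [ij|ji|->] //; [|apply/esym]; apply: bern_comm.
have cXXi i j : (i <= N)%N -> (j <= N)%N -> bern i * bern_inv j = bern_inv j * bern i.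
  by move=> lei lej; apply: (comm_inverse (bernV lej) (bernVl lej)); apply: cX.
have cXi i j : (i <= N)%N -> (j <= N)%N -> bern_inv i * bern_inv j = bern_inv j * bern_inv i.
  move=> lei lej; apply: (comm_inverse (bernV lej) (bernVl lej)); apply/esym; exact: cXXi.
move=> x y; rewrite !mem_cat => /orP[] /mapP[i]; rewrite mem_iota leq0n add0n andTb => lei ->
  /orP[] /mapP[j]; rewrite mem_iota leq0n add0n andTb => lej ->; auto.
by apply/esym; auto.
Qed.

Local Notation inA := (generated (alg_gens (fun x => x \in bern_gens))).

Lemma inA_scale c a : inA a -> inA (c *: a).
Proof.
by move=> ha; rewrite -mulr_algl; apply: gen_mul => //; apply: gen_in; left; exists c.
Qed.

Lemma tinvE i : u i = q^-1 *: t i - (q^-1 * (q - 1))%:A.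
Proof. by rewrite /u scalerBr scalerA. Qed.

(** This fits [t i * bern i.+1 = bern i * u i], since [u i] is a multiple of [t i] plus a scalar;
    the companion [t_mul_forml] fits [u i * bern i = bern i.+1 * t i]. *)
Lemma t_mul_formr i a b : t i * a = b * u i -> inA b ->
  exists b' c, [/\ inA b', inA c & t i * a = b' * t i + c].
Proof.
move=> -> hb; exists (q^-1 *: b), (- (q^-1 * (q - 1)) *: b).
split; rewrite ?tinvE; [exact: inA_scale | exact: inA_scale |].
by rewrite mulrBr mulr_algr scaleNr -scalerAr scalerAl.
Qed.

Lemma t_mul_forml i a b : u i * a = b * t i -> inA a -> inA b ->
  exists b' c, [/\ inA b', inA c & t i * a = b' * t i + c].
Proof.
move=> ua ha hb; exists (q *: b), ((q - 1) *: a).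
split; [exact: inA_scale | exact: inA_scale |].
rewrite -scalerAl -ua tinvE mulrBl -scalerAl mulr_algl scalerBr !scalerA.
by rewrite mulrA divff // mul1r scale1r subrK.
Qed.

(** A qualitative Bernstein-Lusztig relation. Its form survives sums and products of the [a], so it
    is enough to check it on the generators. *)
Lemma t_mul_bern_alg i a : (i < N)%N -> inA a ->
  exists b c, [/\ inA b, inA c & t i * a = b * t i + c].
Proof.
move=> lti; have inX j : (j <= N)%N -> inA (bern j).
  move=> lej; apply: gen_in; right; rewrite mem_cat; apply/orP; left.
  by apply: map_f; rewrite mem_iota.
have inXi j : (j <= N)%N -> inA (bern_inv j).
  move=> lej; apply: gen_in; right; rewrite mem_cat; apply/orP; right.
  by apply: map_f; rewrite mem_iota.
have in0 : inA 0 by rewrite -(scale0r 1); apply: gen_in; left; exists 0.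
have comm_form x : inA x -> x * t i = t i * x ->
    exists b c, [/\ inA b, inA c & t i * x = b * t i + c].
  by move=> hx xt; exists x, 0; split; rewrite ?addr0.
elim=> [x [[c ->]|]|x y hx [b [c [hb hc Ex]]] hy [b' [c' [hb' hc' Ey]]]
  |x y hx [b [c [hb hc Ex]]] hy [b' [c' [hb' hc' Ey]]]].
- apply: comm_form; last by rewrite mulr_algl mulr_algr.
  by apply: gen_in; left; exists c.
- rewrite mem_cat => /orP[] /mapP[j]; rewrite mem_iota => /= lej ->.
    have [ltji|ltij|Eji] := ltngtP j i.
    + by apply: comm_form; [apply: inX | apply: bern_comm_gt].
    + have [ltij2|] := ltnP i.+1 j.
        by apply: comm_form; [apply: inX | apply: bern_comm_lt].
      move=> leji; have -> : j = i.+1 by lia.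
      apply: (@t_mul_formr i _ (bern i)); last by apply: inX; apply: ltnW.
      by rewrite bernS !mulrA t_tinv // mul1r.
    + rewrite Eji; apply: (@t_mul_forml i _ (bern i.+1)); [|by apply: inX; lia|by apply: inX].
      by rewrite bernS -!mulrA tinv_t // mulr1.
  have Xi_comm : bern j * t i = t i * bern j -> bern_inv j * t i = t i * bern_inv j.
    by move=> h; apply/esym/(comm_inverse (bernV lej) (bernVl lej)).
  have [ltji|ltij|Eji] := ltngtP j i.
  + by apply: comm_form; [apply: inXi | apply: Xi_comm; apply: bern_comm_gt].
  + have [ltij2|] := ltnP i.+1 j.
      by apply: comm_form; [apply: inXi | apply: Xi_comm; apply: bern_comm_lt].
    move=> leji; have -> : j = i.+1 by lia.
    apply: (@t_mul_forml i _ (bern_inv i)); [|by apply: inXi|by apply: inXi; lia].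
    by rewrite bern_invS !mulrA tinv_t // mul1r.
  + rewrite Eji; apply: (@t_mul_formr i _ (bern_inv i.+1)); last by apply: inXi.
    by rewrite bern_invS -!mulrA t_tinv // mulr1.
- exists (b + b'), (c + c'); split; [exact: gen_add|exact: gen_add|].
  by rewrite mulrDr Ex Ey mulrDl addrACA.
- exists (b * b'), (b * c' + c * y); split; first exact: gen_mul.
    by apply: gen_add; apply: gen_mul.
  by rewrite mulrA Ex mulrDl -(mulrA b (t i)) Ey mulrDr !mulrA addrA.
Qed.

End Bernstein.

(** * The Hecke algebra over the Bernstein subalgebra *)

Section LeftSpan.
Variables (F : fieldType) (H : algType F) (X G : seq H).
Local Notation inA := (generated (alg_gens (fun x => x \in X))).

Inductive leftspan : H -> Prop :=
| leftspan0 : leftspan 0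
| leftspanS a g h : inA a -> g \in G -> leftspan h -> leftspan (a * g + h).

Lemma leftspanD h h' : leftspan h -> leftspan h' -> leftspan (h + h').
Proof.
move=> hh hh'; elim: hh => [|a g k ha hg _ IH]; first by rewrite add0r.
by rewrite -addrA; apply: leftspanS.
Qed.

Lemma leftspan_mulA c h : inA c -> leftspan h -> leftspan (c * h).
Proof.
move=> hc; elim=> [|a g k ha hg _ IH]; first by rewrite mulr0; apply: leftspan0.
by rewrite mulrDr mulrA; apply: leftspanS => //; apply: gen_mul.
Qed.

Lemma leftspanZ c h : leftspan h -> leftspan (c *: h).
Proof.
by rewrite -mulr_algl; apply: leftspan_mulA; apply: gen_in; left; exists c.
Qed.

Lemma leftspan_mem g : g \in G -> leftspan g.
Proof.
move=> gG; rewrite -[g]addr0 -[g]mul1r.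
by apply: leftspanS => //; [apply: inA1 | apply: leftspan0].
Qed.

Lemma leftspan_mulr k h : (forall g, g \in G -> leftspan (g * k)) ->
  leftspan h -> leftspan (h * k).
Proof.
move=> hk; elim=> [|a g h' ha hg _ IH]; first by rewrite mul0r; apply: leftspan0.
rewrite mulrDl -mulrA; apply: leftspanD => //.
by apply: leftspan_mulA => //; apply: hk.
Qed.

Lemma leftspan_mull t h :
    (forall a, inA a -> exists b c, [/\ inA b, inA c & t * a = b * t + c]) ->
    (forall g, g \in G -> leftspan (t * g)) ->
  leftspan h -> leftspan (t * h).
Proof.
move=> tA tG; elim=> [|a g k /tA[b [c [hb hc E]]] hg _ IH].
  by rewrite mulr0; apply: leftspan0.
rewrite mulrDr mulrA E mulrDl -mulrA.
apply: leftspanD => //; apply: leftspanD; apply: leftspan_mulA => //.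
  exact: tG.
exact: leftspan_mem.
Qed.

(** A coefficient function on [H] cannot distinguish equal entries of [G]; [undup] keeps them from
    being counted twice. *)
Lemma leftspan_coef h : leftspan h -> exists f : H -> H,
  (forall g, inA (f g)) /\ h = \sum_(g <- undup G) f g * g.
Proof.
have in0 : inA 0 by rewrite -(scale0r 1); apply: gen_in; left; exists 0.
elim=> [|a g k ha hg _ [f [hf ->]]].
  by exists (fun _ => 0); split=> //; rewrite big1 // => g _; rewrite mul0r.
exists (fun x => (if x == g then a else 0) + f x); split.
  by move=> x; apply: gen_add => //; case: ifP.
under [RHS]eq_bigr do rewrite mulrDl.
rewrite big_split /=; congr (_ + _).
rewrite (bigD1_seq g) ?mem_undup ?undup_uniq //= eqxx big1 ?addr0 // => x /negPf->.
by rewrite mul0r.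
Qed.

End LeftSpan.

(** The subalgebra generated by the generators satisfies the relations. The universal map into it,
    followed by the inclusion, is the identity of [H] by uniqueness. *)
Lemma hecke_generated (F : fieldType) (z : F) (r : nat) (H : algType F)
    (T : 'I_r -> H) (R Ri : H) :
  is_ext_aff_hecke z T R Ri ->
  forall h, generated (alg_gens (fun x => (exists i, x = T i) \/ x = R \/ x = Ri)) h.
Proof.
set G := fun x => _; case=> relsH univ.
have inG x : G x -> x \in genalg_pred G.
  by move=> Gx; apply/asboolP; apply: gen_in; right.
pose TB i : genAlg G := GenAlg (inG _ (or_introl (ex_intro _ i erefl))).
pose RB : genAlg G := GenAlg (inG _ (or_intror (or_introl erefl))).
pose RiB : genAlg G := GenAlg (inG _ (or_intror (or_intror erefl))).
pose v := (val : genAlg G -> H).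
have vinj : injective v by apply: val_inj.
have vD a b : v (a + b) = v a + v b by apply: (rmorphD (val : genAlg G -> H)).
have vM a b : v (a * b) = v a * v b by apply: (rmorphM (val : genAlg G -> H)).
have v1 : v 1 = 1 by apply: (rmorph1 (val : genAlg G -> H)).
have vZ c a : v (c *: a) = c *: v a by apply: (linearZZ (val : genAlg G -> H)).
have relsB : hecke_rels z TB RB RiB.
  case: relsH => quad comm braid [RRi RiR] RT.
  split=> [i|i j nij|r2 i j ij||i].
  - by apply: vinj; rewrite vM vD !vZ v1; apply: quad.
  - by apply: vinj; rewrite !vM; apply: comm.
  - by apply: vinj; rewrite !vM; apply: braid.
  - by split; apply: vinj; rewrite vM v1.
  - by apply: vinj; rewrite !vM; apply: RT.
have [f [[fD fM f1 fZ] fT fR fRi _]] := univ _ _ _ _ relsB.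
have [g [_ _ _ _ uniq_g]] := univ _ _ _ _ relsH.
move=> h; suff <- : v (f h) = h by case: (f h) => x hx; have /asboolP := hx.
rewrite [RHS](uniq_g id) //; apply: (uniq_g (fun h => v (f h))).
- by split=> [a b|a b||c a]; rewrite ?fD ?fM ?f1 ?fZ.
- by move=> i; rewrite fT.
- by rewrite fR.
- by rewrite fRi.
Qed.

Section HeckeFacts.
Variables (F : fieldType) (z : F) (r : nat) (H : algType F).
Variables (T : 'I_r -> H) (R Ri : H).
Hypothesis rels : hecke_rels z T R Ri.

Lemma hecke_comm (i j : 'I_r) : (i.+1 < r)%N -> (j.+1 < r)%N ->
  (i.+1 < j)%N -> T i * T j = T j * T i.
Proof.
case: rels => _ comm _ _ _ lti ltj ij; apply: comm.
by rewrite /adjmod !val_ordS //; lia.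
Qed.

Lemma hecke_braid (i j : 'I_r) : (i.+1 < r)%N -> (j.+1 < r)%N ->
  j = i.+1 :> nat -> T i * T j * T i = T j * T i * T j.
Proof.
case: rels => _ _ braid _ _ lti ltj ij; apply: braid; first by lia.
by rewrite /adjmod !val_ordS //; lia.
Qed.

End HeckeFacts.

(** It suffices that the left span of [G] contains 1 and is stable under left multiplication by the
    generators. For [r >= 2], [X] consists of the Bernstein elements with their inverses and [G] of
    the [T_w]. *)
Lemma hecke_left_span (F : fieldType) (z : F) (r : nat) (H : algType F)
    (T : 'I_r -> H) (R Ri : H) :
  (0 < r)%N -> z != 0 -> is_ext_aff_hecke z T R Ri ->
  exists X G : seq H, {in X &, forall x y, x * y = y * x} /\
    forall h, exists f : H -> H,
      (forall g, generated (alg_gens (fun x => x \in X)) (f g)) /\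
      h = \sum_(g <- G) f g * g.
Proof.
move=> r0 z0 hH; have rels := hH.1.
have gen := hecke_generated hH.
have [quad _ _ [RRi RiR] RT] := rels.
suff [X [G [commX [G1 hT hR hRi]]]] : exists X G : seq H,
    {in X &, forall x y, x * y = y * x} /\
    [/\ leftspan X G 1, forall i h, leftspan X G h -> leftspan X G (T i * h),
        forall h, leftspan X G h -> leftspan X G (R * h) &
        forall h, leftspan X G h -> leftspan X G (Ri * h)].
  exists X, (undup G); split=> // h; apply: leftspan_coef; rewrite -[h]mulr1.
  elim: (gen h) (1) G1 => [x [[c ->]|[[i ->]|[->|->]]]|x y _ IHx _ IHy|x y _ IHx _ IHy] v hv.
  - by rewrite mulr_algl; apply: leftspanZ.
  - exact: hT.
  - exact: hR.
  - exact: hRi.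
  - by rewrite mulrDl; apply: leftspanD; [apply: IHx|apply: IHy].
  - by rewrite -mulrA; apply/IHx/IHy.
case: r T r0 hH rels gen quad RT => // -[|N'] T _ hH rels gen quad RT.
  (* For [r = 1] there is still one generator [T ord0]; it commutes with [R] because [ordS] fixes
     the only index. *)
  exists [:: R; Ri], [:: 1; T ord0].
  have inR : generated (alg_gens (fun x => x \in [:: R; Ri])) R.
    by apply: gen_in; right; rewrite inE eqxx.
  have inRi : generated (alg_gens (fun x => x \in [:: R; Ri])) Ri.
    by apply: gen_in; right; rewrite !inE eqxx orbT.
  have RT0 : R * T ord0 = T ord0 * R by rewrite RT; congr (T _ * _); apply: val_inj.
  have TRi : T ord0 * Ri = Ri * T ord0.
    by apply: (comm_inverse RRi RiR); rewrite RT0.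
  split.
    move=> x y; rewrite !inE => /orP[] /eqP-> /orP[] /eqP-> //; by rewrite RRi RiR.
  split.
  - by apply: leftspan_mem; rewrite inE eqxx.
  - move=> i h; rewrite (ord1 i); apply: leftspan_mull => [a ha|g].
      exists a, 0; split=> //; first by rewrite -(scale0r 1); apply: gen_in; left; exists 0.
      rewrite addr0; elim: ha => [x [[c ->]|]|x y _ Hx _ Hy|x y _ Hx _ Hy].
      + by rewrite mulr_algl mulr_algr.
      + by rewrite !inE => /orP[] /eqP->.
      + by rewrite mulrDl mulrDr Hx Hy.
      + by rewrite mulrA Hx -mulrA Hy mulrA.
    rewrite !inE => /orP[] /eqP->.
      by rewrite mulr1; apply: leftspan_mem; rewrite !inE eqxx orbT.
    rewrite quad; apply: leftspanD; apply: leftspanZ; apply: leftspan_mem;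
      by rewrite !inE eqxx ?orbT.
  - by move=> h; apply: leftspan_mulA.
  - by move=> h; apply: leftspan_mulA.
set q := z ^+ 2 in quad.
have q0 : q != 0 by rewrite expf_neq0.
pose t i : H := T (inord i).
have o_val i : (i < N'.+2)%N -> @inord N'.+1 i = i :> nat by move=> lti; rewrite inordK.
have ordS_o i : (i.+1 < N'.+2)%N -> ordS (@inord N'.+1 i) = inord i.+1.
  by move=> lti; apply: val_inj; rewrite /= o_val ?(ltnW lti) // o_val // modn_small.
have tquad i : (i < N'.+1)%N -> t i * t i = (q - 1) *: t i + q%:A by move=> _; apply: quad.
have tcomm i j : (i.+1 < j)%N -> (j < N'.+1)%N -> t i * t j = t j * t i.
  by move=> ij ltj; apply: (hecke_comm rels); rewrite !o_val; lia.
have tbraid i : (i.+1 < N'.+1)%N -> t i * t i.+1 * t i = t i.+1 * t i * t i.+1.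
  by move=> lti; apply: (hecke_braid rels); rewrite !o_val; lia.
have Rt i : (i < N'.+1)%N -> R * t i = t i.+1 * R.
  by move=> lti; rewrite /t RT ordS_o.
have RtN : R * t N'.+1 = t 0 * R.
  rewrite /t RT; congr (T _ * _); apply: val_inj; rewrite /= !inordK //.
  by rewrite modnn.
pose Xl := bern_gens q N' t R Ri.
pose G := [seq Tw T w | w <- enum {: 'S_N'.+2}].
exists Xl, G; split; first exact: (bern_gens_comm q0 tquad tcomm tbraid RRi RiR Rt RtN).
have TwG w : Tw T w \in G by apply: map_f; rewrite mem_enum.
have hcomm := hecke_comm rels; have hbraid := hecke_braid rels.
have G1 : leftspan Xl G 1 by rewrite -(Tw1 hcomm hbraid); apply: leftspan_mem.
have rT (i : 'I_N'.+2) h : (i.+1 < N'.+2)%N -> leftspan Xl G h -> leftspan Xl G (h * T i).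
  move=> lti; apply: leftspan_mulr => _ /mapP[w _ ->].
  have [di|nd] := boolP (descent w i); last first.
    by rewrite (Tw_up hcomm hbraid) //; apply: leftspan_mem.
  rewrite (Tw_down hcomm hbraid quad) //.
  by apply: leftspanD; apply: leftspanZ; apply: leftspan_mem.
(* The rules for [Tw] concern right multiplication. A left multiple of [T_w] is read as a word in
   the finite generators and rebuilt from the left end by right multiplications. *)
have word s : all (fun k : 'I_N'.+2 => (k.+1 < N'.+2)%N) s ->
    leftspan Xl G (\prod_(k <- s) T k).
  elim/last_ind: s => [|s i IH]; first by rewrite big_nil.
  by rewrite all_rcons => /andP[lti hs]; rewrite Tword_rcons; apply: rT => //; apply: IH.
have lt_closed i h : (i < N'.+1)%N -> leftspan Xl G h -> leftspan Xl G (t i * h).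
  move=> lti; apply: leftspan_mull => [a|_ /mapP[w _ ->]].
    exact: (t_mul_bern_alg q0 tquad tcomm tbraid RRi RiR Rt).
  have [s rs ss] := reduced_exists w; rewrite (Tw_reduced hcomm hbraid (conj rs ss)).
  rewrite -[t i * _](big_cons _ _ (inord i) s predT T).
  by apply: word; case/andP: rs => rs _; rewrite /= rs o_val ?andbT; lia.
have lu_closed i h : (i < N'.+1)%N -> leftspan Xl G h -> leftspan Xl G (tinv q t i * h).
  move=> lti hh; rewrite tinvE mulrBl -scalerAl mulr_algl -scaleNr.
  by apply: leftspanD; apply: leftspanZ => //; apply: lt_closed.
have lD k h : (k <= N'.+1)%N -> leftspan Xl G h -> leftspan Xl G (desc_prod t k * h).
  elim: k h => [|k IH] h lek hh; first by rewrite mul1r.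
  by rewrite desc_prodS -mulrA; apply: lt_closed => //; apply: IH => //; apply: ltnW.
have lDv k h : (k <= N'.+1)%N -> leftspan Xl G h -> leftspan Xl G (desc_prod_inv q t k * h).
  elim: k h => [|k IH] h lek hh; first by rewrite mul1r.
  by rewrite desc_prod_invS -mulrA; apply: IH; [apply: ltnW | apply: lu_closed].
have DDvN : desc_prod t N'.+1 * desc_prod_inv q t N'.+1 = 1.
  by exact: (desc_prodV q0 tquad (leqnn _)).
have inX : generated (alg_gens (fun x => x \in Xl)) (bern q N' t R 0).
  by apply: gen_in; right; rewrite mem_cat map_f // mem_iota.
have inXi : generated (alg_gens (fun x => x \in Xl)) (bern_inv q N' t Ri 0).
  by apply: gen_in; right; rewrite mem_cat orbC map_f // mem_iota.
have hR h : leftspan Xl G h -> leftspan Xl G (R * h).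
  move=> hh; have -> : R = bern q N' t R 0 * desc_prod_inv q t N'.+1.
    by rewrite bern0 -mulrA DDvN mulr1.
  by rewrite -mulrA; apply: leftspan_mulA => //; apply: lDv.
have hRi h : leftspan Xl G h -> leftspan Xl G (Ri * h).
  move=> hh; have -> : Ri = desc_prod t N'.+1 * bern_inv q N' t Ri 0.
    by rewrite bern_inv0 mulrA DDvN mul1r.
  by rewrite -mulrA; apply: lD => //; apply: leftspan_mulA.
split=> // i h hh; have [lti|gei] := ltnP i N'.+1.
  have -> : T i = t i by rewrite /t inord_val.
  exact: lt_closed.
have -> : T i = R * t N' * Ri.
  rewrite Rt // -mulrA RRi mulr1 /t; congr T; apply: val_inj.
  by rewrite /= inordK //; have := ltn_ord i; lia.
by rewrite -!mulrA; apply: hR; apply: lt_closed => //; apply: hRi.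
Qed.

Theorem theorem4p1p6 (F : fieldType) (z : F) (n r : nat) (H : algType F)
    (T : 'I_r -> H) (Trho Trhoinv : H) :
  (0 < n)%N -> (0 < r)%N ->
  z != 0 -> (forall k : nat, (0 < k)%N -> z ^+ k != 1) ->
  is_ext_aff_hecke z T Trho Trhoinv ->
  forall (M : lmodType F) (act : (Pt n T -> Pt n T) -> M -> M),
    is_Smod act -> is_Ssimple act -> findim M.
Proof.
move=> _ r0 z0 z_not_root hH M act actM simpleM.
have rels := hH.1; have [quad _ _ _ _] := rels.
have q_not_root k : (0 < k)%N -> (z ^+ 2) ^+ k != 1.
  by move=> k0; rewrite -exprM; apply: z_not_root; rewrite muln_gt0.
have reg (l : comp_of n r) : exists y, xl T l * y * xl T l = xl T l.
  exact: (xl_regular quad (hecke_comm rels) (hecke_braid rels) q_not_root).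
have [y xyx] := choice reg.
apply: (findim_of_maximal_left_ideals xyx actM simpleM) => K maxK.
have [X [G [commX spanG]]] := hecke_left_span r0 z0 hH.
exact: (maximal_left_ideal_finite_codim commX spanG maxK).
Qed.
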